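(* Let $\Omega$ be a domain in $\mathbb{C}^n$ such that the infinitesimal Kobayashi metric $F_K$ of $\Omega$ is nondegenerate. Let $f:\Omega\to\mathbb{C}$ be a holomorphic function. Then $f$ is normal on $\Omega$ if and only if the family $$\mathcal{F}=\{f\circ\varphi \mid \varphi:\mathbb{D}\to\Omega\ \text{holomorphic}\}$$ is a normal family on $\mathbb{D}$.
   Context: $\mathbb{D}=\{\lambda\in\mathbb{C}:|\lambda|<1\}$; a domain is a connected open set. Infinitesimal Kobayashi metric on $\Omega$: for $z\in\Omega$, $v\in\mathbb{C}^n$, $$F_K(z,v)=\inf\{\alpha>0 \mid \exists\,\varphi:\mathbb{D}\to\Omega \text{ holomorphic with } \varphi(0)=z,\ \varphi'(0)=v/\alpha\}.$$ Nondegenerate means $F_K(z,v)>0$ for all $z\in\Omega$ and all $v\in\mathbb{C}^n$ with $v\neq 0$. Levi form: for a real $C^2$ function $u$ on $\Omega$, $L_z(u,v)=\sum_{k,l=1}^n \frac{\partial^2 u}{\partial z_k\,\partial\bar z_l}(z)\,v_k\bar v_l$. For holomorphic $f$ one has $L_z(\log(1+|f|^2),v)=\frac{|df_z(v)|^2}{(1+|f(z)|^2)^2}$. Normal function on $\Omega$: a holomorphic function $f:\Omega\to\mathbb{C}$ is normal on $\Omega$ if there exists a constant $C>0$ such that $L_z(\log(1+|f|^2),v)\le C\,F_K(z,v)^2$ for all $z\in\Omega$ and all $v\in\mathbb{C}^n$. Normal family on $\mathbb{D}$: a family of holomorphic functions on $\mathbb{D}$ such that every sequence in it contains either a subsequence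 converging uniformly on every compact subset of $\mathbb{D}$ to a finite limit function, or a subsequence converging uniformly to $\infty$ on every compact subset of $\mathbb{D}$. *)

(* Defs.v *)
(* C is R[i] for R : realType, and C^n is 'rV[R[i]]_n, whose norm is the sup
   norm (hence the usual topology). *)
From HB Require Import structures.
From mathcomp Require Import all_boot all_order all_algebra.
From mathcomp Require Import complex.
From mathcomp Require Import all_classical all_reals all_analysis.

Set Implicit Arguments.
Unset Strict Implicit.
Unset Printing Implicit Defensive.

Import Order.TTheory GRing.Theory Num.Theory.
Import numFieldNormedType.Exports.

Local Open Scope classical_set_scope.
Local Open Scope ring_scope.
Local Open Scope complex_scope.

(* R[i] as a normed space over itself: the generic structure that the library
   puts on every numFieldType. *)
#[export, non_forgetful_inheritance]
HB.instance Definition _ (R : rcfType) := NormedModule.copy R[i] (R[i])^o.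

Definition unit_disk (R : realType) : set R[i] := [set z | `|z| < 1].
Arguments unit_disk : clear implicits.

(* On an open set, Frechet differentiability over C. Functions are total;
   their values outside the set play no role. *)
Definition holomorphic_on (R : realType) (V W : normedModType R[i])
    (U : set V) (g : V -> W) : Prop :=
  forall z, U z -> differentiable g z.

Definition holomorphic_disk (R : realType) (n : nat) (Omega : set 'rV[R[i]]_n)
    (phi : R[i] -> 'rV[R[i]]_n) : Prop :=
  holomorphic_on (unit_disk R) phi /\
  (forall z, unit_disk R z -> Omega (phi z)).

Definition domain (R : realType) (n : nat) (Omega : set 'rV[R[i]]_n) : Prop :=
  open Omega /\ connected Omega.

Definition kobayashi_metric (R : realType) (n : nat) (Omega : set 'rV[R[i]]_n)
    (z v : 'rV[R[i]]_n) : R :=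
  inf [set alpha : R | 0 < alpha /\
    exists phi : R[i] -> 'rV[R[i]]_n,
      [/\ holomorphic_disk Omega phi, phi 0 = z
        & derive1 phi 0 = (alpha^-1)%:C *: v]].

Definition kobayashi_nondegenerate (R : realType) (n : nat)
    (Omega : set 'rV[R[i]]_n) : Prop :=
  forall z v : 'rV[R[i]]_n, Omega z -> v != 0 ->
    0 < kobayashi_metric Omega z v.

(* Derivative along the real line t |-> z + t w of a complex-valued function,
   taken on its real and imaginary parts. *)
Definition real_derive (R : realType) (n : nat) (w : 'rV[R[i]]_n)
    (g : 'rV[R[i]]_n -> R[i]) (z : 'rV[R[i]]_n) : R[i] :=
  derive1 (fun t : R => complex.Re (g (z + t%:C *: w))) 0 +i*
  derive1 (fun t : R => complex.Im (g (z + t%:C *: w))) 0.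

(* d/dz_k = (d/dx_k - i d/dy_k) / 2, where z_k = x_k + i y_k. *)
Definition wirtinger (R : realType) (n : nat) (k : 'I_n)
    (g : 'rV[R[i]]_n -> R[i]) (z : 'rV[R[i]]_n) : R[i] :=
  (real_derive (delta_mx 0 k) g z
   - 'i%C * real_derive ('i%C *: delta_mx 0 k) g z) / 2.

(* d/d\bar z_k = (d/dx_k + i d/dy_k) / 2. *)
Definition wirtinger_bar (R : realType) (n : nat) (k : 'I_n)
    (g : 'rV[R[i]]_n -> R[i]) (z : 'rV[R[i]]_n) : R[i] :=
  (real_derive (delta_mx 0 k) g z
   + 'i%C * real_derive ('i%C *: delta_mx 0 k) g z) / 2.

(* L_z(u, v) = \sum_(k, l) d^2 u / (dz_k d\bar z_l) (z) v_k \bar v_l. *)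
Definition levi_form (R : realType) (n : nat) (u : 'rV[R[i]]_n -> R)
    (z v : 'rV[R[i]]_n) : R[i] :=
  \sum_(k < n) \sum_(l < n)
    wirtinger k (wirtinger_bar l (fun w => (u w)%:C)) z * v 0 k * (v 0 l)^*.

(* The inequality is in the order of R[i], where x <= y means that y - x is
   real and nonnegative; the Levi form of a C^2 function is real. *)
Definition normal_function (R : realType) (n : nat) (Omega : set 'rV[R[i]]_n)
    (f : 'rV[R[i]]_n -> R[i]) : Prop :=
  holomorphic_on Omega f /\
  exists C : R, 0 < C /\
    forall z v : 'rV[R[i]]_n, Omega z ->
      levi_form (fun w => ln (1 + ComplexField.Normc.normc (f w) ^+ 2)) z v
        <= (C * kobayashi_metric Omega z v ^+ 2)%:C.

Definition normal_family_on_disk (R : realType) (F : set (R[i] -> R[i])) : Prop :=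
  (forall g, F g -> holomorphic_on (unit_disk R) g) /\
  forall u : nat -> R[i] -> R[i], (forall m, F (u m)) ->
    exists s : nat -> nat, {homo s : m p / (m < p)%N} /\
      ((exists g : R[i] -> R[i], forall K : set R[i],
          compact K -> K `<=` unit_disk R ->
          {uniform K, (fun m => u (s m)) @ \oo --> g}) \/
       (forall K : set R[i], compact K -> K `<=` unit_disk R ->
          forall M : R, \forall m \near \oo,
            forall z, K z -> M%:C < `|u (s m) z|)).

(* Main.v *)
(* By [levi_form_log], normality of [f] says that the spherical derivative of
   [f \o phi] at a point [w] of the disk is at most a constant times
   [1 / (1 - |w|)], uniformly in the disks [phi], so the theorem is Marty's
   criterion. If [f] is not normal, the definition of the Kobayashi metric as an
   infimum yields disks [phi_m] along which the spherical derivative at [0] tends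
   to infinity; Cauchy's estimate for [f \o phi_m], or for its inverse, excludes
   both kinds of convergence. Conversely, fix an ultrafilter refining the tail
   filter. The functions [1 / (1 + |u_m|^2)] are locally equi-Lipschitz and have a
   limit [q] along it. Where [q] is nonzero the [u_m] are locally bounded, where
   it vanishes the [1 / u_m] are, and Hurwitz's theorem makes the zero set of [q]
   open, hence empty or everything. A subsequence is then extracted by exhausting
   the disk by compact sets.

   The function theory rests on one fact, [punctured_mean_bound]: a function
   continuous at [a] and holomorphic elsewhere near [a] is bounded at [a] by twice its
   maximum on a circle of centre [a]. Applied to difference quotients it gives the
   Cauchy estimates, and applied twice the differentiability of derivatives. *)

Require Import Defs.
From HB Require Import structures.
From mathcomp Require Import all_boot all_order all_algebra.
From mathcomp Require Import complex.
From mathcomp Require Import all_classical all_reals all_analysis.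
From mathcomp Require Import ring lra.

Set Implicit Arguments.
Unset Strict Implicit.
Unset Printing Implicit Defensive.

Import Order.TTheory GRing.Theory Num.Theory.
Import numFieldNormedType.Exports.

Local Open Scope classical_set_scope.
Local Open Scope ring_scope.
Local Open Scope complex_scope.

Import ComplexField.Normc.

(** * The modulus and complex derivatives *)

(** Only the existence of the constants matters. Complex integrals and increments are estimated
    through their real and imaginary parts, and each such passage costs a factor 2; this is the
    origin of most numerical constants. Up to an affine change, [1 / (1 + |u|^2)] is the height of
    [u] on the Riemann sphere: it is bounded by 1, its limit value 0 stands for infinity, and its
    derivative is controlled by the spherical derivative alone. One bounded family thus covers the
    finite and the infinite alternative. The ultrafilter provides its limit at all points at once.
    Holomorphy passes to such pointwise limits because the first-order Taylor error is at most a
    constant times the square of the distance, the constant depending only on a bound and a radius.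
    Hurwitz's theorem comes from the mean bound. Let zero-free functions tend to [h] with [h a = 0].
    If [h] had no zero on some small circle around [a], the inverses would be bounded on that circle
    but not at [a]. So [h] has zeros on all small circles, is divisible by every power of [z - a],
    and vanishes near [a]. *)

(** The form without division also makes sense at [z = a]. The field is arbitrary because both [R]
    and [R[i]] occur below. *)
Lemma is_derive_nearP (K : numFieldType) (f : K -> K) (a l : K) :
  is_derive a 1 f l <-> forall e : K, 0 < e ->
    \forall z \near a, `|f z - f a - l * (z - a)| <= e * `|z - a|.
Proof.
have cvgP : is_derive a 1 f l <->
    (fun h => h^-1 *: ((f \o shift a) (h *: 1) - f a)) @ 0^' --> l.
  split=> [[df <-] //|fl]; split; first by apply/cvg_ex; exists l.
  exact: cvg_lim fl.
have scA (h : K) : h *: (1 : K) = h by exact: mulr1.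
have scE (h k : K) : h *: k = h * k by [].
have nE z : z != a -> forall e, (`|l - (z - a)^-1 * (f (z - a + a) - f a)| <= e)
    = (`|f z - f a - l * (z - a)| <= e * `|z - a|).
  move=> za e; have z0 : z - a != 0 by rewrite subr_eq0.
  rewrite -[RHS](ler_pM2r (_ : 0 < `|z - a|^-1)) ?invr_gt0 ?normr_gt0//.
  rewrite mulfK ?normr_eq0// -normfV -normrM mulrBl mulfK// subrK distrC.
  by rewrite [X in X - l]mulrC.
apply: (iff_trans cvgP); split.
  move=> /cvgrPdist_le fl e /fl /nbhs_ballP[d /= d0 dP].
  apply/nbhs_ballP; exists d => //= z zd.
  have [->|zNa] := eqVneq z a; first by rewrite !subrr mulr0 subr0 !normr0 mulr0.
  rewrite -nE//; have := dP (z - a); rewrite /= scA scE; apply.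
    by move: zd; rewrite -!ball_normE /= sub0r normrN distrC.
  by rewrite subr_eq0.
move=> H; apply/cvgrPdist_le => e /H /nbhs_ballP[d /= d0 dP].
apply/nbhs_ballP; exists d => //= h hd hN0; rewrite scA scE.
have haN : h + a != a by rewrite -subr_eq0 addrK.
have := nE _ haN e; rewrite addrK => ->; rewrite -[X in _ * `|X|](addrK a).
rewrite -[X in _ - _ - _ * X](addrK a); apply: dP.
by move: hd; rewrite -!ball_normE /= sub0r normrN opprD addrCA subrr addr0 normrN.
Qed.

Section Norm.
Variable R : realType.
Implicit Types (z w : R[i]) (P : set R[i]).

Lemma normr_normc z : `|z| = (normc z)%:C. Proof. by []. Qed.

Lemma normc_ge0 z : 0 <= normc z.
Proof. by case: z => a b; exact: sqrtr_ge0. Qed.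

Lemma normcB z w : normc (z - w) = normc (w - z).
Proof. by rewrite -normcN opprB. Qed.

Lemma normc_real (x : R) : normc x%:C = `|x|.
Proof. by rewrite /normc /= expr0n addr0 sqrtr_sqr. Qed.

Lemma normc_gt0 z : (0 < normc z) = (z != 0).
Proof.
rewrite lt_neqAle normc_ge0 andbT eq_sym; congr (~~ _).
by apply/eqP/eqP => [/eq0_normc|->]; rewrite ?normc0.
Qed.

Lemma Re_le_normc z : `|complex.Re z| <= normc z.
Proof. by have := normc_ge_Re z; rewrite normr_normc lecR. Qed.

Lemma normcX z k : normc (z ^+ k) = normc z ^+ k.
Proof. by elim: k => [|k IH]; rewrite ?normc1// !exprS normcM IH. Qed.

Lemma normc_i : normc ('i%C : R[i]) = 1.
Proof. by rewrite /normc expr0n add0r expr1n sqrtr1. Qed.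

Lemma Im_le_normc z : `|complex.Im z| <= normc z.
Proof.
have := Re_le_normc (z * 'i%C); rewrite normcM normc_i mulr1.
by rewrite ReiNIm normrN.
Qed.

Lemma normc_le_ReIm z : normc z <= `|complex.Re z| + `|complex.Im z|.
Proof.
rewrite {1}[z]complexE (le_trans (le_normcD _ _))// normcM normc_i mul1r.
by rewrite !normc_real.
Qed.

Lemma sqr_normcE z : normc z ^+ 2 = complex.Re z ^+ 2 + complex.Im z ^+ 2.
Proof. by case: z => a b; rewrite sqr_sqrtr// addr_ge0// sqr_ge0. Qed.

Lemma reD z w : complex.Re (z + w) = complex.Re z + complex.Re w.
Proof. by case: z w => [? ?] [? ?]. Qed.

Lemma imD z w : complex.Im (z + w) = complex.Im z + complex.Im w.
Proof. by case: z w => [? ?] [? ?]. Qed.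

Lemma reB z w : complex.Re (z - w) = complex.Re z - complex.Re w.
Proof. by case: z w => [? ?] [? ?]. Qed.

Lemma imB z w : complex.Im (z - w) = complex.Im z - complex.Im w.
Proof. by case: z w => [? ?] [? ?]. Qed.

Lemma reM z w : complex.Re (z * w) =
  complex.Re z * complex.Re w - complex.Im z * complex.Im w.
Proof. by case: z w => [? ?] [? ?]. Qed.

Lemma imM z w : complex.Im (z * w) =
  complex.Re z * complex.Im w + complex.Im z * complex.Re w.
Proof. by case: z w => [? ?] [? ?]. Qed.

(** Radii of balls in [R[i]] are elements of [R[i]]; being positive they are real, so their real
    parts serve as radii in [R], where [lra] works. *)
Lemma nbhs_normcP (a : R[i]) P :
  nbhs a P <-> exists2 d : R, 0 < d & forall z, normc (z - a) < d -> P z.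
Proof.
split.
  move/nbhs_ballP => [e /= e0 aP].
  have eE : e = (complex.Re e)%:C by rewrite RRe_real// gtr0_real.
  exists (complex.Re e); first by rewrite -ltcR -eE.
  move=> z za; apply: aP; rewrite -ball_normE /= normr_normc eE ltcR.
  by rewrite normcB.
move=> [d d0 aP]; apply/nbhs_ballP; exists d%:C; first by rewrite /= ltcR.
by move=> z; rewrite -ball_normE /= normr_normc ltcR normcB => /aP.
Qed.

Lemma is_derive_normcP (f : R[i] -> R[i]) (a l : R[i]) :
  is_derive a 1 f l <-> forall e : R, 0 < e -> exists2 d : R, 0 < d &
    forall z, normc (z - a) < d ->
      normc (f z - f a - l * (z - a)) <= e * normc (z - a).
Proof.
apply: (iff_trans (is_derive_nearP _ _ _)); split=> H e e0.
  have /H /nbhs_normcP[d d0 dP] : 0 < e%:C :> R[i] by rewrite ltcR.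
  exists d => // z /dP.
  by rewrite !normr_normc -(rmorphM (real_complex R)) lecR.
have eE : e = (complex.Re e)%:C by rewrite RRe_real// gtr0_real.
have /H[d d0 dP] : 0 < complex.Re e by rewrite -ltcR -eE.
apply/nbhs_normcP; exists d => // z /dP.
by rewrite eE !normr_normc -(rmorphM (real_complex R)) lecR.
Qed.

Lemma differentiable_is_derive (f : R[i] -> R[i]) z :
  differentiable f z -> is_derive z 1 f (derive1 f z).
Proof. by move=> /derivable1_diffP fd; rewrite derive1E; split. Qed.

Lemma is_derive_differentiable (f : R[i] -> R[i]) z l :
  is_derive z 1 f l -> differentiable f z.
Proof. by move=> [fd _]; apply/derivable1_diffP. Qed.

Lemma is_derive_derive1 (f : R[i] -> R[i]) z l :
  is_derive z 1 f l -> derive1 f z = l.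
Proof. by move=> [_ <-]; rewrite derive1E. Qed.

Lemma continuous_normcP (f : R[i] -> R[i]) a :
  {for a, continuous f} <-> forall e : R, 0 < e -> exists2 d : R, 0 < d &
    forall z, normc (z - a) < d -> normc (f z - f a) <= e.
Proof.
split=> [/cvgrPdist_le fa e e0|H].
  have /fa /nbhs_normcP[d d0 dP] : 0 < e%:C :> R[i] by rewrite ltcR.
  by exists d => // z /dP; rewrite normr_normc lecR normcB.
rewrite /prop_for /continuous_at; apply/(@cvgrPdist_le _ _ _ (nbhs a)) => e e0.
have eE : e = (complex.Re e)%:C by rewrite RRe_real// gtr0_real.
have /H[d d0 dP] : 0 < complex.Re e by rewrite -ltcR -eE.
apply/nbhs_normcP; exists d => // z /dP.
by rewrite normr_normc eE lecR normcB.
Qed.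

(** Restricting to a real line and splitting into parts gives real functions, to which the real mean
    value theorem and real integration apply. *)
Lemma is_derive_line (f : R[i] -> R[i]) (z w l : R[i]) (t : R) :
  is_derive (z + t%:C * w) 1 f l ->
  is_derive t 1 (fun s => complex.Re (f (z + s%:C * w))) (complex.Re (l * w)) /\
  is_derive t 1 (fun s => complex.Im (f (z + s%:C * w))) (complex.Im (l * w)).
Proof.
move=> /is_derive_normcP fl.
have {}fl (e : R) : 0 < e -> \forall s \near t,
    normc (f (z + s%:C * w) - f (z + t%:C * w) - (l * w) * (s - t)%:C)
      <= e * `|s - t|.
  (* The summand 1 keeps the divisor positive when [w = 0]. *)
  move=> e0; have c0 : 0 < normc w + 1 by rewrite ltr_wpDl// normc_ge0.
  have [|d d0 dP] := fl (e / (normc w + 1)); first by rewrite divr_gt0.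
  apply/nbhs_ballP; exists (d / (normc w + 1)); first by rewrite /= divr_gt0.
  move=> s; rewrite -ball_normE /= ltr_pdivlMr// distrC => sd.
  have E : z + s%:C * w - (z + t%:C * w) = (s - t)%:C * w.
    by rewrite rmorphB/= mulrBl; ring.
  have E' : l * w * (s - t)%:C = l * ((s - t)%:C * w) by ring.
  have := dP (z + s%:C * w); rewrite E -E' normcM normc_real => H.
  apply: le_trans (H _) _.
    by apply: le_lt_trans sd; rewrite ler_wpM2l// lerDl.
  rewrite [leLHS](_ : _ = e * `|s - t| * (normc w / (normc w + 1))); last ring.
  rewrite ler_piMr ?mulr_ge0 ?(ltW e0)//.
  by rewrite ler_pdivrMr// mul1r lerDl.
have ReR (x : R[i]) (y : R) : complex.Re (x * y%:C) = complex.Re x * y.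
  by rewrite reM mulr0 subr0.
have ImR (x : R[i]) (y : R) : complex.Im (x * y%:C) = complex.Im x * y.
  by rewrite imM mulr0 add0r.
split; apply/is_derive_nearP => e /fl; apply: filterS => s.
  by rewrite -reB -ReR -reB; apply: le_trans; exact: Re_le_normc.
by rewrite -imB -ImR -imB; apply: le_trans; exact: Im_le_normc.
Qed.

End Norm.

(** * Integrals of complex-valued functions of a real variable *)

Section Integral.
Variable R : realType.
Implicit Types (a b m : R) (g h : R -> R[i]).
Local Notation mu := (@lebesgue_measure R).

Definition cint a b g : R[i] :=
  (\int[mu]_(t in `[a, b]) complex.Re (g t)) +i*
  (\int[mu]_(t in `[a, b]) complex.Im (g t)).

(** Continuity is two-sided even at the end points: the integrands are restrictions of functions
    differentiable at every point of the closed segment. *)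
Definition ccontinuous a b g := forall t, a <= t <= b ->
  {for t, continuous (fun s => complex.Re (g s))} /\
  {for t, continuous (fun s => complex.Im (g s))}.

Lemma ccontinuous_sub a b c d g : a <= c -> d <= b ->
  ccontinuous a b g -> ccontinuous c d g.
Proof.
move=> ac db gc t /andP[ct td]; apply: gc.
by rewrite (le_trans ac)//= (le_trans td).
Qed.

Lemma ccontinuousD a b g h : ccontinuous a b g -> ccontinuous a b h ->
  ccontinuous a b (fun t => g t + h t).
Proof.
move=> gc hc t /[dup] /gc[g1 g2] /hc[h1 h2]; split.
  rewrite (_ : (fun _ => _) = (fun s => complex.Re (g s) + complex.Re (h s))).
    exact: continuousD.
  by apply/funext => s; rewrite reD.
rewrite (_ : (fun _ => _) = (fun s => complex.Im (g s) + complex.Im (h s))).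
  exact: continuousD.
by apply/funext => s; rewrite imD.
Qed.

Lemma ccontinuousM a b g h : ccontinuous a b g -> ccontinuous a b h ->
  ccontinuous a b (fun t => g t * h t).
Proof.
move=> gc hc t /[dup] /gc[g1 g2] /hc[h1 h2]; split.
  rewrite (_ : (fun _ => _) = (fun s => complex.Re (g s) * complex.Re (h s)
      - complex.Im (g s) * complex.Im (h s))); last first.
    by apply/funext => s; rewrite reM.
  by apply: continuousB; exact: continuousM.
rewrite (_ : (fun _ => _) = (fun s => complex.Re (g s) * complex.Im (h s)
    + complex.Im (g s) * complex.Re (h s))); last first.
  by apply/funext => s; rewrite imM.
by apply: continuousD; exact: continuousM.
Qed.

Lemma ccontinuous_cst a b (c : R[i]) : ccontinuous a b (fun=> c).
Proof. by move=> t _; split; exact: cst_continuous. Qed.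

Lemma ccontinuous_integrable a b g : ccontinuous a b g ->
  mu.-integrable `[a, b] (EFin \o (fun t => complex.Re (g t))) /\
  mu.-integrable `[a, b] (EFin \o (fun t => complex.Im (g t))).
Proof.
move=> gc; split; apply: continuous_compact_integrable;
  do ?[exact: segment_compact];
  by apply: continuous_in_subspaceT => t; rewrite inE /= in_itv /= => /gc[].
Qed.

Lemma cintD a b g h : ccontinuous a b g -> ccontinuous a b h ->
  cint a b (fun t => g t + h t) = cint a b g + cint a b h.
Proof.
move=> /ccontinuous_integrable[g1 g2] /ccontinuous_integrable[h1 h2].
rewrite /cint; apply/eqP; rewrite eq_complex /=; apply/andP; split; apply/eqP.
  by rewrite -RintegralD//; apply: eq_Rintegral => t _; rewrite reD.
by rewrite -RintegralD//; apply: eq_Rintegral => t _; rewrite imD.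
Qed.

Lemma cintZ a b (c : R[i]) g : ccontinuous a b g ->
  cint a b (fun t => c * g t) = c * cint a b g.
Proof.
move=> /ccontinuous_integrable[g1 g2].
have m1 : measurable `[a, b] by [].
apply/eqP; rewrite eq_complex reM imM /=; apply/andP; split; apply/eqP.
  rewrite -!RintegralZl// -RintegralB//; last 2 first.
  - exact: integrableZl g1.
  - exact: integrableZl g2.
  by apply: eq_Rintegral => t _; rewrite reM.
rewrite -!RintegralZl// -RintegralD//; last 2 first.
- exact: integrableZl g2.
- exact: integrableZl g1.
by apply: eq_Rintegral => t _; rewrite imM.
Qed.

Lemma cintB a b g h : ccontinuous a b g -> ccontinuous a b h ->
  cint a b (fun t => g t - h t) = cint a b g - cint a b h.
Proof.
move=> gc hc; have Nc : ccontinuous a b (fun=> -1 : R[i]) by exact: ccontinuous_cst.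
have -> : (fun t => g t - h t) = (fun t => g t + (-1) * h t).
  by apply/funext => t; rewrite mulN1r.
by rewrite (cintD gc (ccontinuousM Nc hc)) (cintZ (-1) hc) mulN1r.
Qed.

Lemma cint_cst a b (c : R[i]) : a <= b -> cint a b (fun=> c) = (b - a)%:C * c.
Proof.
move=> ab; apply/eqP; rewrite eq_complex reM imM /= !mul0r subr0 addr0.
rewrite !Rintegral_cst//= lebesgue_measure_itv/= lte_fin.
move: ab; rewrite le_eqVlt => /predU1P[->|->]; last first.
  by rewrite -EFinB/= !(mulrC (b - a)) !eqxx.
by rewrite ltxx subrr !mul0r !mulr0 eqxx.
Qed.

Lemma cint_split a m b g : a <= m -> m <= b -> ccontinuous a b g ->
  cint a b g = cint a m g + cint m b g.
Proof.
move=> am mb gc.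
have [g1 g2] := ccontinuous_integrable gc.
have [h1 h2] := ccontinuous_integrable (ccontinuous_sub am (lexx b) gc).
have sub : `]m, b] `<=` `[m, b]%classic.
  by move=> t /=; rewrite !in_itv /= => /andP[/ltW -> ->].
apply/eqP; rewrite eq_complex /=; apply/andP; split; apply/eqP.
  have := @Rintegral_itvB _ _ (BLeft a) (BRight b) m g1.
  rewrite !bnd_simp => /(_ am mb)/eqP; rewrite subr_eq addrC => /eqP ->.
  congr (_ + _); rewrite Rintegral_itv_obnd_cbnd//.
  exact: integrableS h1.
have := @Rintegral_itvB _ _ (BLeft a) (BRight b) m g2.
rewrite !bnd_simp => /(_ am mb)/eqP; rewrite subr_eq addrC => /eqP ->.
congr (_ + _); rewrite Rintegral_itv_obnd_cbnd//.
exact: integrableS h2.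
Qed.

(* The factor 2 comes from bounding real and imaginary parts separately. *)
Lemma cint_bound a b g (M : R) : a <= b -> ccontinuous a b g ->
  (forall t, a <= t <= b -> normc (g t) <= M) ->
  normc (cint a b g) <= 2 * (b - a) * M.
Proof.
move=> ab /ccontinuous_integrable[g1 g2] gM.
have bd (f : R -> R) : mu.-integrable `[a, b] (EFin \o f) ->
    (forall t, a <= t <= b -> `|f t| <= M) ->
    `|\int[mu]_(t in `[a, b]) f t| <= (b - a) * M.
  move=> fi fM; apply: (le_trans (le_normr_Rintegral _ fi)) => //.
  have cM : \int[mu]_(t in `[a, b]) M = (b - a) * M.
    by have := congr1 (@complex.Re R) (cint_cst M%:C ab); rewrite reM /= mul0r subr0.
  rewrite -cM; apply: le_Rintegral => //.
  - exact: integrable_norm fi.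
  - have [] // := @ccontinuous_integrable a b (fun=> M%:C).
    exact: ccontinuous_cst.
apply: le_trans (normc_le_ReIm _) _.
rewrite (_ : 2 * _ * M = (b - a) * M + (b - a) * M); last by ring.
apply: lerD; apply: bd => // t /gM.
  by apply: le_trans; exact: Re_le_normc.
by apply: le_trans; exact: Im_le_normc.
Qed.

End Integral.

(** * Goursat's theorem for rectangles *)

Section Goursat.
Variable R : realType.
Implicit Types (a b c d x y t : R) (G : R[i] -> R[i]).

(* The integral of [G dz] over the boundary of [[a, b] x [c, d]], counterclockwise. *)
Definition rint G a b c d : R[i] :=
  'i%C * (cint c d (fun t => G (b +i* t)) - cint c d (fun t => G (a +i* t)))
  - (cint a b (fun t => G (t +i* d)) - cint a b (fun t => G (t +i* c))).

(** Separate continuity is enough, as [rint] only integrates along horizontal and vertical segments;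
    it covers the sides of all subrectangles as well. *)
Definition rcont G a b c d :=
  (forall x, a <= x <= b -> ccontinuous c d (fun t => G (x +i* t))) /\
  (forall y, c <= y <= d -> ccontinuous a b (fun t => G (t +i* y))).

Lemma rcont_sub G a b c d a' b' c' d' : a <= a' -> b' <= b -> c <= c' ->
  d' <= d -> rcont G a b c d -> rcont G a' b' c' d'.
Proof.
move=> aa bb cc dd [G1 G2]; split.
  move=> x /andP[ax xb]; apply: (ccontinuous_sub cc dd); apply: G1.
  by rewrite (le_trans aa)// (le_trans xb).
move=> x /andP[ax xb]; apply: (ccontinuous_sub aa bb); apply: G2.
by rewrite (le_trans cc)// (le_trans xb).
Qed.

Lemma is_derive_rcont G a b c d :
  (forall x y, a <= x <= b -> c <= y <= d ->
    exists l, is_derive (x +i* y) 1 G l) ->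
  rcont G a b c d.
Proof.
move=> Gd.
have cont (f : R -> R) t l : is_derive t 1 f l -> {for t, continuous f}.
  by move=> [df _]; apply: differentiable_continuous; exact/derivable1_diffP.
split=> [x xab t tcd|y ycd t tab].
  have [l Gl] := Gd _ _ xab tcd.
  have E s : x%:C + s%:C * 'i = x +i* s :> R[i].
    by apply/eqP; rewrite eq_complex /=; apply/andP; split; apply/eqP; ring.
  have := @is_derive_line R G x%:C 'i l t; rewrite E => /(_ Gl)[/cont + /cont].
  have F (h : R[i] -> R) : (fun s => h (G (x%:C + s%:C * 'i))) =
      (fun s => h (G (x +i* s))) by apply/funext => s; rewrite E.
  by rewrite !F.
have [l Gl] := Gd _ _ tab ycd.
have E s : y *i + s%:C * 1 = s +i* y :> R[i].
  by apply/eqP; rewrite eq_complex /=; apply/andP; split; apply/eqP; ring.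
have := @is_derive_line R G (y *i) 1 l t; rewrite E => /(_ Gl)[/cont + /cont].
have F (h : R[i] -> R) : (fun s => h (G (y *i + s%:C * 1))) =
    (fun s => h (G (s +i* y))) by apply/funext => s; rewrite E.
by rewrite !F.
Qed.

Lemma rint_splitx G a m b c d : a <= m -> m <= b -> c <= d -> rcont G a b c d ->
  rint G a b c d = rint G a m c d + rint G m b c d.
Proof.
move=> am mb cd [G1 G2].
rewrite /rint (cint_split am mb (G2 d _)) ?lexx ?cd//.
by rewrite (cint_split am mb (G2 c _)) ?lexx ?cd//; ring.
Qed.

Lemma rint_splity G a b c m d : a <= b -> c <= m -> m <= d -> rcont G a b c d ->
  rint G a b c d = rint G a b c m + rint G a b m d.
Proof.
move=> ab cm md [G1 G2].
rewrite /rint (cint_split cm md (G1 b _)) ?lexx ?ab//.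
by rewrite (cint_split cm md (G1 a _)) ?lexx ?ab//; ring.
Qed.

Lemma rintB G G' a b c d : a <= b -> c <= d ->
  rcont G a b c d -> rcont G' a b c d ->
  rint (fun w => G w - G' w) a b c d = rint G a b c d - rint G' a b c d.
Proof.
move=> ab cd [G1 G2] [G1' G2']; rewrite /rint !cintB;
  do ?[by [apply: G1; rewrite ?lexx ?ab | apply: G2; rewrite ?lexx ?cd
         | apply: G1'; rewrite ?lexx ?ab | apply: G2'; rewrite ?lexx ?cd]].
by ring.
Qed.

(** The difference between opposite sides is constant, so the vertical and the horizontal pair both
    contribute ['i * B * (b - a) * (d - c)], with opposite signs. *)
Lemma rint_affine (A B : R[i]) a b c d : a <= b -> c <= d ->
  rcont (fun w => A + B * w) a b c d ->
  rint (fun w => A + B * w) a b c d = 0.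
Proof.
move=> ab cd [G1 G2]; rewrite /rint -!cintB;
  do ?[by [apply: G1; rewrite ?lexx ?ab | apply: G2; rewrite ?lexx ?cd]].
have E1 t : A + B * (b +i* t) - (A + B * (a +i* t)) = B * (b - a)%:C.
  rewrite opprD addrACA subrr add0r -mulrBr; congr (_ * _).
  by apply/eqP; rewrite eq_complex /= subrr !eqxx.
have E2 t : A + B * (t +i* d) - (A + B * (t +i* c)) = B * ('i%C * (d - c)%:C).
  rewrite opprD addrACA subrr add0r -mulrBr; congr (_ * _).
  by apply/eqP; rewrite eq_complex /= subrr; apply/andP; split; apply/eqP; ring.
under eq_fun do rewrite E1.
under [X in _ - cint _ _ X]eq_fun do rewrite E2.
by rewrite !cint_cst//; ring.
Qed.

(** The 4 is the factor 2 of [cint_bound] times two sides in each direction. *)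
Lemma rint_bound G a b c d (M : R) : a <= b -> c <= d -> rcont G a b c d ->
  (forall x y, a <= x <= b -> c <= y <= d -> normc (G (x +i* y)) <= M) ->
  normc (rint G a b c d) <= 4 * ((b - a) + (d - c)) * M.
Proof.
move=> ab cd [G1 G2] GM.
have B4 (p q r s : R[i]) : normc ('i%C * (p - q) - (r - s)) <=
    normc p + normc q + normc r + normc s.
  apply: le_trans (le_normcD _ _) _; rewrite normcM normc_i mul1r normcN.
  rewrite -!addrA addrA; apply: lerD; rewrite -[X in _ <= _ + X]normcN;
    exact: le_normcD.
apply: (le_trans (B4 _ _ _ _)).
have -> : 4 * (b - a + (d - c)) * M = 2 * (d - c) * M + 2 * (d - c) * M +
    2 * (b - a) * M + 2 * (b - a) * M by ring.
by do !apply: lerD; apply: cint_bound => //;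
  do ?[by [apply: G1; rewrite ?lexx ?ab | apply: G2; rewrite ?lexx ?cd]];
  move=> t tI; apply: GM => //; rewrite ?lexx ?ab ?cd.
Qed.

End Goursat.

Section GoursatTheorem.
Variable R : realType.
Implicit Types (a b c d x y t : R) (G : R[i] -> R[i]).

(** The supremum of the left ends works, since every right end is an upper bound for them. *)
Lemma nested_segments (u : nat -> R) (L : nat -> R) :
  (forall k, u k <= u k.+1) -> (forall k, u k.+1 + L k.+1 <= u k + L k) ->
  (forall k, 0 <= L k) -> exists x, forall k, u k <= x <= u k + L k.
Proof.
move=> u1 u2 L0.
have u1' k j : u k <= u (j + k)%N by elim: j => // j IH; exact: le_trans (u1 _).
have u2' k j : u (j + k)%N + L (j + k)%N <= u k + L k.
  by elim: j => // j IH; apply: le_trans (u2 _) IH.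
have ub k j : u j <= u k + L k.
  have [kj|jk] := leqP k j.
    rewrite -(subnK kj); rewrite (le_trans _ (u2' k (j - k)%N))// lerDl.
    exact: L0.
  rewrite -(subnK (ltnW jk)) (le_trans (u1' j (k - j)%N))// lerDl.
  exact: L0.
exists (sup (range u)) => k; apply/andP; split.
  apply: ub_le_sup; last by exists k.
  by exists (u 0%N + L 0%N) => _ [j _ <-].
apply: ge_sup; first by exists (u 0%N), 0%N.
by move=> _ [j _ <-].
Qed.

Lemma normc_sub_le (x y x' y' : R) :
  normc (x +i* y - (x' +i* y')) <= `|x - x'| + `|y - y'|.
Proof. exact: normc_le_ReIm. Qed.

(** Quadrisection: one quarter always carries at least a fourth of the integral. The nested
    rectangles shrink to a point where [G] is affine up to [e] times the distance. The affine part
    integrates to 0, and the error is at most [e] times perimeter times diameter, of order [4 ^- k],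
    which bounds the integral by a multiple of [e]. *)
Lemma goursat G a b c d : a <= b -> c <= d ->
  (forall x y, a <= x <= b -> c <= y <= d ->
    exists l, is_derive (x +i* y) 1 G l) ->
  rint G a b c d = 0.
Proof.
move=> ab cd Gd; have Gc := is_derive_rcont Gd.
pose M := normc (rint G a b c d).
pose w k := (b - a) / 2 ^+ k; pose h k := (d - c) / 2 ^+ k.
have wS k : w k = w k.+1 + w k.+1 by rewrite /w exprS invfM; field.
have hS k : h k = h k.+1 + h k.+1 by rewrite /h exprS invfM; field.
have w0 k : 0 <= w k by rewrite divr_ge0 ?subr_ge0// exprn_ge0.
have h0 k : 0 <= h k by rewrite divr_ge0 ?subr_ge0// exprn_ge0.
pose I k (p : R * R) := rint G p.1 (p.1 + w k) p.2 (p.2 + h k).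
pose inv k (p : R * R) := [/\ a <= p.1, p.1 + w k <= b, c <= p.2,
   p.2 + h k <= d & M / 4 ^+ k <= normc (I k p)].
(* A rectangle is encoded by its lower left corner, its sides being [w k] and [h k]. The invariant
   is a premise under the existential so that [choice] yields a total function. *)
have step (kp : nat * (R * R)) : exists q, inv kp.1 kp.2 ->
    [/\ inv kp.1.+1 q, kp.2.1 <= q.1, q.1 + w kp.1.+1 <= kp.2.1 + w kp.1,
      kp.2.2 <= q.2 & q.2 + h kp.1.+1 <= kp.2.2 + h kp.1].
  case: kp => k [x y]; rewrite /fst /snd.
  have [Hi|nHi] := pselect (inv k (x, y)); last by exists (0, 0).
  have [xa xb yc yd HM] := Hi; rewrite /= in xa xb yc yd.
  have cont : rcont G x (x + w k) y (y + h k) by exact: rcont_sub Gc.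
  have wk := w0 k.+1; have hk := h0 k.+1; have wSk := wS k; have hSk := hS k.
  have HI : I k (x, y) = I k.+1 (x, y) + I k.+1 (x + w k.+1, y)
      + I k.+1 (x, y + h k.+1) + I k.+1 (x + w k.+1, y + h k.+1).
    rewrite /I /fst /snd -(addrA x) -(addrA y) -wS -hS.
    have -> : rint G x (x + w k) y (y + h k) =
        rint G x (x + w k.+1) y (y + h k) +
        rint G (x + w k.+1) (x + w k) y (y + h k).
      by apply: rint_splitx => //; lra.
    have -> : rint G x (x + w k.+1) y (y + h k) =
        rint G x (x + w k.+1) y (y + h k.+1) +
        rint G x (x + w k.+1) (y + h k.+1) (y + h k).
      by apply: rint_splity; last (apply: rcont_sub cont => //); lra.
    have -> : rint G (x + w k.+1) (x + w k) y (y + h k) =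
        rint G (x + w k.+1) (x + w k) y (y + h k.+1) +
        rint G (x + w k.+1) (x + w k) (y + h k.+1) (y + h k).
      by apply: rint_splity; last (apply: rcont_sub cont => //); lra.
    by rewrite [LHS]addrACA [LHS]addrA.
  have [q qS qM] : exists2 q : R * R, [/\ x <= q.1, q.1 + w k.+1 <= x + w k,
      y <= q.2 & q.2 + h k.+1 <= y + h k] & M / 4 ^+ k.+1 <= normc (I k.+1 q).
    apply: contrapT => /forall2NP H.
    have K q : x <= q.1 -> q.1 + w k.+1 <= x + w k -> y <= q.2 ->
        q.2 + h k.+1 <= y + h k -> normc (I k.+1 q) < M / 4 ^+ k.+1.
      move=> q1 q2 q3 q4; rewrite ltNge; apply/negP => qq.
      by have [|] := H q; apply.
    have := HM; rewrite leNgt => /negP; apply; rewrite HI.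
    apply: le_lt_trans (le_normcD _ _) _.
    have K4 : normc (I k.+1 (x + w k.+1, y + h k.+1)) < M / 4 ^+ k.+1.
      by apply: K; rewrite /fst /snd; move: wk hk wSk hSk; clear; lra.
    have K3 : normc (I k.+1 (x, y + h k.+1)) < M / 4 ^+ k.+1.
      by apply: K; rewrite /fst /snd; move: wk hk wSk hSk; clear; lra.
    have K2 : normc (I k.+1 (x + w k.+1, y)) < M / 4 ^+ k.+1.
      by apply: K; rewrite /fst /snd; move: wk hk wSk hSk; clear; lra.
    have K1 : normc (I k.+1 (x, y)) < M / 4 ^+ k.+1.
      by apply: K; rewrite /fst /snd; move: wk hk wSk hSk; clear; lra.
    have -> : M / 4 ^+ k = 4 * (M / 4 ^+ k.+1) by rewrite exprS invfM; field.
    apply: le_lt_trans (lerD (le_normcD _ _) (lexx _)) _.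
    apply: le_lt_trans (lerD (lerD (le_normcD _ _) (lexx _)) (lexx _)) _.
    rewrite (_ : 4 * _ = M / 4 ^+ k.+1 + M / 4 ^+ k.+1 + M / 4 ^+ k.+1
      + M / 4 ^+ k.+1); last by ring.
    exact: ltrD (ltrD (ltrD K1 K2) K3) K4.
  case: qS => q1 q2 q3 q4; exists q => _; split=> //; split=> //.
  - exact: le_trans q1.
  - exact: le_trans xb.
  - exact: le_trans q3.
  - exact: le_trans yd.
have [F FP] := choice step.
pose p := fix p k := if k is k'.+1 then F (k', p k') else (a, c).
have pinv k : inv k (p k).
  elim: k => [|k IH]; last by have [] := FP (k, p k) IH.
  rewrite /inv /I /w /h /p /fst /snd !expr0 !divr1 !lexx ![_ + (_ - _)]addrC !subrK.
  by split=> //; exact: lexx.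
have [x0 x0P] : exists x, forall k, (p k).1 <= x <= (p k).1 + w k.
  by apply: nested_segments => // k; have [] := FP (k, p k) (pinv k).
have [y0 y0P] : exists y, forall k, (p k).2 <= y <= (p k).2 + h k.
  by apply: nested_segments => // k; have [] := FP (k, p k) (pinv k).
have [l /is_derive_normcP Gl] : exists l, is_derive (x0 +i* y0) 1 G l.
  have [x1 x2 y1 y2 _] := pinv 0%N.
  apply: Gd.
    by have /andP[/(le_trans x1) -> /le_trans ->] := x0P 0%N.
  by have /andP[/(le_trans y1) -> /le_trans ->] := y0P 0%N.
(* In the choice of [e] that follows, [S ^+ 2 + 1] replaces [S ^+ 2] to allow a rectangle reduced to
   a point. *)
suff ME (e : R) : 0 < e -> M <= 4 * e * ((b - a) + (d - c)) ^+ 2.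
  apply: eq0_normc; apply/eqP; rewrite eq_le normc_ge0 andbT.
  set S := (b - a) + (d - c) in ME.
  apply/ler_addgt0Pl => e e0; rewrite addr0.
  have S0 : 0 < 4 * (S ^+ 2 + 1) by rewrite mulr_gt0// ltr_wpDl// sqr_ge0.
  apply: (le_trans (ME (e / (4 * (S ^+ 2 + 1))) _)); first by rewrite divr_gt0.
  rewrite [leLHS](_ : _ = e * (S ^+ 2 / (S ^+ 2 + 1))); last first.
    by field; rewrite gt_eqF// -(pmulr_rgt0 _ (_ : 0 < 4)).
  rewrite ler_piMr ?(ltW e0)// ler_pdivrMr ?mul1r ?lerDl//.
  by rewrite -(pmulr_rgt0 _ (_ : 0 < 4)).
move=> e0; have [dl dl0 dlP] := Gl e e0.
pose S k := w k + h k.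
have [k Sk] : exists k, S k < dl.
  have : (fun k => ((b - a) + (d - c)) * (2^-1 : R) ^+ k) @ \oo --> ((b - a) + (d - c)) * 0.
    apply: cvgM; first exact: cvg_cst.
    by apply: cvg_expr; rewrite ger0_norm ?invr_ge0// invf_lt1// ltr1n.
  rewrite mulr0 => /cvgrPdist_lt /(_ _ dl0)[k _ /(_ k (leqnn k))] /=.
  rewrite sub0r normrN => kS; exists k; rewrite /S /w /h -mulrDl -exprVn.
  exact: le_lt_trans (ler_norm _) kS.
have [xa xb yc yd HM] := pinv k.
set x := (p k).1 in xa xb; set y := (p k).2 in yc yd.
have cont : rcont G x (x + w k) y (y + h k) by exact: rcont_sub Gc.
(* The first-order Taylor polynomial of [G] at the common point of the rectangles. *)
pose aff v := (G (x0 +i* y0) - l * (x0 +i* y0)) + l * v.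
have affc : rcont aff x (x + w k) y (y + h k).
  apply: is_derive_rcont => x1 y1 _ _; exists l; apply/is_derive_normcP => e1 e10.
  exists 1 => // z _; rewrite /aff opprD addrACA subrr add0r -mulrBr subrr normc0.
  by rewrite mulr_ge0 ?normc_ge0// ltW.
have : normc (rint (fun v => G v - aff v) x (x + w k) y (y + h k)) <=
    4 * ((x + w k - x) + (y + h k - y)) * (e * S k).
  apply: rint_bound; rewrite ?lerDl//.
    apply: is_derive_rcont => x1 y1 x1P y1P.
    have [||l1 Gl1] := Gd x1 y1.
    - by move: x1P => /andP[/(le_trans xa) -> /le_trans ->].
    - by move: y1P => /andP[/(le_trans yc) -> /le_trans ->].
    have Gaff : is_derive (x1 +i* y1) 1 aff l.
      apply/is_derive_normcP => e1 e10; exists 1 => // z _.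
      rewrite /aff opprD addrACA subrr add0r -mulrBr subrr normc0.
      by rewrite mulr_ge0 ?normc_ge0// ltW.
    by exists (l1 - l); exact: is_deriveB.
  move=> x1 y1 /andP[x1a x1b] /andP[y1a y1b].
  have /andP[x0a x0b] := x0P k; have /andP[y0a y0b] := y0P k.
  have dist : normc (x1 +i* y1 - (x0 +i* y0)) <= S k.
    apply: le_trans (normc_sub_le _ _ _ _) _; apply: lerD.
      by rewrite ler_norml -/x in x0a x0b *; apply/andP; split; lra.
    by rewrite ler_norml -/y in y0a y0b *; apply/andP; split; lra.
  rewrite (_ : G _ - aff _ = G (x1 +i* y1) - G (x0 +i* y0)
      - l * (x1 +i* y1 - (x0 +i* y0))); last by rewrite /aff; ring.
  apply: le_trans (dlP _ _) _; first exact: le_lt_trans dist Sk.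
  by rewrite ler_pM2l.
rewrite rintB ?lerDl// rint_affine ?lerDl// subr0 => H.
have := le_trans HM H.
(* Perimeter and diameter each contribute [2 ^- k], which cancels the [4 ^+ k]. *)
rewrite ler_pdivrMr ?exprn_gt0//; move/le_trans; apply.
rewrite /S /w /h le_eqVlt; apply/orP; left; apply/eqP.
rewrite (_ : (4 : R) ^+ k = 2 ^+ k * 2 ^+ k); last by rewrite -exprMn -natrM.
by field; rewrite expf_neq0.
Qed.

End GoursatTheorem.

(** * Circle means *)

Section ComplexExp.
Variable R : realType.
Implicit Types (z w : R[i]).

Definition expc z : R[i] :=
  (expR (complex.Re z) * cos (complex.Im z)) +i*
  (expR (complex.Re z) * sin (complex.Im z)).

Lemma expcD z w : expc (z + w) = expc z * expc w.
Proof.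
rewrite /expc reD imD expRD cosD sinD.
by apply/eqP; rewrite eq_complex /=; apply/andP; split; apply/eqP; ring.
Qed.

Lemma normc_expc z : normc (expc z) = expR (complex.Re z).
Proof.
rewrite /normc /expc !exprMn -mulrDr cos2Dsin2 mulr1 sqrtr_sqr.
by rewrite ger0_norm// expR_ge0.
Qed.

Lemma expc_2pi (x : R) : expc (x +i* (2 * pi)) = expc (x +i* 0).
Proof.
have -> : 2 * pi = pi + pi :> R by ring.
rewrite /expc /= cosD sinD cospi sinpi cos0 sin0.
by congr (_ +i* _); ring.
Qed.

(** By [expcD] only the expansion at 0 is needed, and it follows from those of [expR], [cos] and
    [sin]. *)
Lemma is_derive_expc z : is_derive z 1 expc (expc z).
Proof.
suff H0 (e : R) : 0 < e -> exists2 d : R, 0 < d &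
    forall h, normc h < d -> normc (expc h - 1 - h) <= e * normc h.
  apply/is_derive_normcP => e e0; have c0 := expR_gt0 (complex.Re z).
  have [|d d0 dP] := H0 (e / expR (complex.Re z)); first by rewrite divr_gt0.
  exists d => // w wz.
  have -> : expc w = expc z * expc (w - z) by rewrite -expcD addrC subrK.
  rewrite (_ : _ - _ = expc z * (expc (w - z) - 1 - (w - z))); last by ring.
  rewrite normcM normc_expc mulrC -ler_pdivlMr//.
  by apply: le_trans (dP _ wz) _; rewrite mulrAC.
move=> e0.
have near0 (f : R -> R) l : is_derive (0 : R) 1 f l -> forall e : R, 0 < e ->
    exists2 d : R, 0 < d & forall x, `|x| < d -> `|f x - f 0 - l * x| <= e * `|x|.
  move=> /is_derive_nearP fl e1 /fl /nbhs_ballP[d /= d0 dP]; exists d => // x xd.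
  by have := dP x; rewrite -ball_normE /= sub0r normrN subr0 => /(_ xd).
(* The real and imaginary errors will be at most 3 and 4 times [e1 * N], hence the 8; [e1 <= 1] is
   used for [|1 + a| <= 2]. *)
have [e1 [e10 e11 e1e]] : exists e1 : R, [/\ 0 < e1, e1 <= 1 & 8 * e1 <= e].
  exists (Num.min 1 (e / 8)); split; rewrite ?lt_min ?ltr01 ?divr_gt0//.
    by rewrite ge_min lexx.
  by rewrite mulrC -ler_pdivlMr// ge_min lexx orbT.
have [d1 d10 H1] := near0 _ _ (is_derive_expR 0) e1 e10.
have [d2 d20 H2] := near0 _ _ (is_derive_cos 0) e1 e10.
have [d3 d30 H3] := near0 _ _ (is_derive_sin 0) e1 e10.
pose d := Num.min (Num.min d1 d2) (Num.min d3 e1).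
have d0 : 0 < d by rewrite !lt_min d10 d20 d30 e10.
exists d => // h; rewrite !lt_min => /andP[/andP[hd1 hd2] /andP[hd3 hd4]].
have [Rh Ih] := (Re_le_normc h, Im_le_normc h).
have N0 := normc_ge0 h; move: N0 hd1 hd2 hd3 hd4 Rh Ih; move: (normc h) => N.
case: h => a b; rewrite /complex.Re /complex.Im => N0 hd1 hd2 hd3 hd4 Rh Ih.
have := H1 a (le_lt_trans Rh hd1); rewrite expR0 mul1r => {}H1.
have := H2 b (le_lt_trans Ih hd2); rewrite cos0 sin0 oppr0 mul0r subr0 => {}H2.
have := H3 b (le_lt_trans Ih hd3); rewrite sin0 cos0 subr0 mul1r => {}H3.
have {}H1 := le_trans H1 (ler_wpM2l (ltW e10) Rh).
have {}H2 := le_trans H2 (ler_wpM2l (ltW e10) Ih).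
have {}H3 := le_trans H3 (ler_wpM2l (ltW e10) Ih).
have cb1 : `|cos b| <= 1 by rewrite ler_norml cos_geN1 cos_le1.
have sb1 : `|sin b| <= 1 by rewrite ler_norml sin_geN1 sin_le1.
have ae1 : `|a| <= e1 by exact: le_trans Rh (ltW hd4).
have sbN : `|sin b| <= 2 * N.
  rewrite -[sin b](subrK b); apply: le_trans (ler_normD _ _) _.
  rewrite mulrDl !mul1r lerD//; apply: le_trans H3 _.
  by rewrite -[leRHS]mul1r ler_wpM2r.
have HR : `|expR a * cos b - 1 - a| <= 3 * (e1 * N).
  rewrite (_ : _ - a = (expR a - 1 - a) * cos b + (1 + a) * (cos b - 1));
    last by ring.
  apply: le_trans (ler_normD _ _) _; rewrite !normrM.
  rewrite (_ : 3 * _ = e1 * N * 1 + 2 * (e1 * N)); last by ring.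
  apply: lerD; first exact: ler_pM.
  apply: ler_pM => //; apply: le_trans (ler_normD _ _) _; rewrite normr1.
  lra.
have HI : `|expR a * sin b - b| <= 4 * (e1 * N).
  rewrite (_ : _ - b = (expR a - 1 - a) * sin b + (sin b - b) + a * sin b);
    last by ring.
  apply: le_trans (ler_normD _ _) _.
  rewrite (_ : 4 * _ = e1 * N * 1 + e1 * N + e1 * (2 * N)); last by ring.
  apply: lerD; last by rewrite normrM; exact: ler_pM.
  apply: le_trans (ler_normD _ _) _; apply: lerD => //.
  by rewrite normrM; exact: ler_pM.
apply: le_trans (normc_le_ReIm _) _; rewrite /= subr0.
apply: le_trans (lerD HR HI) _; rewrite -mulrDl mulrA ler_wpM2r//.
lra.
Qed.

End ComplexExp.

Section CircleMean.
Variable R : realType.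
Implicit Types (a z : R[i]) (g : R[i] -> R[i]) (r M : R).

(* Goursat's theorem for [w |-> g (a + r * expc w)] on [[s, 0] x [0, 2 pi]]: the
   horizontal sides cancel by periodicity, so the mean of [g] over the circle of
   radius [r * expR s] does not depend on [s], and it tends to [g a] as [s] goes
   to -oo. *)
Lemma punctured_mean_bound g a (d r M : R) : 0 < r -> r < d ->
  {for a, continuous g} ->
  (forall z, 0 < normc (z - a) < d -> differentiable g z) ->
  (forall z, normc (z - a) = r -> normc (g z) <= M) ->
  normc (g a) <= 2 * M.
Proof.
move=> r0 rd ga gd gM.
pose G w := g (a + r%:C * expc w).
have Gd x y : x <= 0 -> exists l, is_derive (x +i* y) 1 G l.
  move=> x0; exists (derive1 G (x +i* y)); apply: differentiable_is_derive.
  apply: (@differentiable_comp _ _ _ _ (fun w => a + r%:C * expc w)).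
    apply: differentiableD; first exact: differentiable_cst.
    apply: differentiableM; first exact: differentiable_cst.
    exact: is_derive_differentiable (is_derive_expc _).
  apply: gd; rewrite addrC addKr normcM normc_real gtr0_norm// normc_expc.
  rewrite mulr_gt0 ?expR_gt0//= (le_lt_trans _ rd)// ler_piMr ?(ltW r0)//.
  by rewrite -expR0 ler_expR.
have pi20 : 0 <= 2 * pi :> R by rewrite mulr_ge0// pi_ge0.
have pi2p : 0 < 2 * pi :> R by rewrite mulr_gt0// pi_gt0.
(* Continuity on a vertical segment is read off a rectangle of width 0. *)
have Gc x : x <= 0 -> ccontinuous 0 (2 * pi) (fun t => G (x +i* t)).
  move=> x0; have [|G1 _] := @is_derive_rcont _ G x x 0 (2 * pi).
    by move=> x1 y /andP[_ x1x] _; apply: Gd; exact: le_trans x1x x0.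
  by apply: G1; rewrite !lexx.
pose V x := cint 0 (2 * pi) (fun t => G (x +i* t)).
have VE s : s <= 0 -> V s = V 0.
  move=> s0; have := @goursat _ G s 0 0 (2 * pi) s0 pi20.
  move=> /(_ (fun x y xP _ => Gd x y (proj2 (andP xP)))).
  rewrite /rint -/(V 0) -/(V s).
  rewrite (_ : (fun t => G (t +i* (2 * pi))) = (fun t => G (t +i* 0))); last first.
    by apply/funext => t; rewrite /G expc_2pi.
  have i0 : 'i%C != 0 :> R[i] by rewrite eq_complex /= oner_eq0 andbF.
  have cancel (p r' : R[i]) : 'i%C * p - (r' - r') = 'i%C * p.
    by rewrite subrr subr0.
  rewrite cancel => /eqP.
  by rewrite mulf_eq0 (negbTE i0) orFb subr_eq0 eq_sym => /eqP.
have V0 : normc (V 0) <= 2 * (2 * pi) * M.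
  have := @cint_bound _ 0 (2 * pi) (fun t => G (0 +i* t)) M pi20 (Gc _ (lexx 0)).
  rewrite subr0; apply => t _; apply: gM.
  by rewrite addrC addKr normcM normc_real normc_expc /= expR0 mulr1 gtr0_norm.
suff H (e : R) : 0 < e -> normc (g a) <= 2 * M + 2 * e.
  apply/ler_addgt0Pr => e e0; have := H (e / 2); rewrite divr_gt0// => /(_ isT).
  by rewrite mulrCA divff// mulr1.
move=> e0; have /continuous_normcP/(_ e e0)[dl dl0 dlP] := ga.
have [s s0 sd] : exists2 s : R, s <= 0 & r * expR s < dl.
  (* With [s = ln q], the bound 1 gives [s <= 0], and the other one puts the circle of radius
     [r * expR s] where [g] is within [e] of [g a]. *)
  pose q := Num.min 1 (dl / 2 / r).
  have q0 : 0 < q by rewrite lt_min ltr01 !divr_gt0.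
  exists (ln q); first by rewrite -ln1 ler_ln ?posrE// ge_min lexx.
  rewrite lnK ?posrE// (@le_lt_trans _ _ (dl / 2))//; last by lra.
  by rewrite mulrC -ler_pdivlMr// ge_min lexx orbT.
have := @cint_bound _ 0 (2 * pi) (fun t => G (s +i* t) - g a) e pi20.
rewrite subr0 => Hb.
have {}Hb : normc (V s - (2 * pi)%:C * g a) <= 2 * (2 * pi) * e.
  rewrite -[2 * pi as X in X%:C]subr0 -cint_cst// -cintB; last 2 first.
  - exact: Gc.
  - exact: ccontinuous_cst.
  apply: Hb.
    rewrite (_ : (fun _ => _) = (fun t => G (s +i* t) + (fun=> - g a) t))//.
    by apply: ccontinuousD; [exact: Gc | exact: ccontinuous_cst].
  move=> t _; apply: dlP.
  by rewrite addrC addKr normcM normc_real normc_expc gtr0_norm.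
have : normc ((2 * pi)%:C * g a) <= 2 * (2 * pi) * M + 2 * (2 * pi) * e.
  rewrite (_ : _ * g a = V 0 - (V s - (2 * pi)%:C * g a)); last first.
    by rewrite VE//; ring.
  by apply: le_trans (le_normcD _ _) _; rewrite normcN; exact: lerD.
rewrite normcM normc_real gtr0_norm//.
rewrite (_ : _ + _ = 2 * pi * (2 * M + 2 * e)); last by ring.
by rewrite ler_pM2l.
Qed.

End CircleMean.

(** * Limits along ultrafilters and Cauchy estimates *)

Section UltraLimit.
Variables (R : realType) (T : Type) (U : set_system T).
Context {UU : UltraFilter U}.

(** Compactness of a segment gives a cluster point. An ultrafilter converges to it: if the indices
    close to [l] did not form a set of [U], the complement would be in [U], against clustering. *)
Lemma ultra_bounded_real (x : T -> R) (M : R) : (\forall i \near U, `|x i| <= M) ->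
  exists l, forall e : R, 0 < e -> \forall i \near U, `|x i - l| <= e.
Proof.
move=> xM.
have PU : ProperFilter (x @ U) by exact: fmap_proper_filter.
have [] := @segment_compact R (- M) M (x @ U) PU _.
  by apply: filterS xM => i; rewrite /= in_itv /= ler_norml.
move=> l [_ lc]; exists l => e e0.
have [//|nUe] := in_ultra_setVsetC [set i | `|x i - l| <= e] UU.
have FA : (x @ U) (~` [set y : R | `|y - l| <= e]) by exact: nUe.
have [y [/= ye yl]] := lc _ _ FA (nbhsx_ballx l e e0).
by case: ye; move: yl; rewrite -ball_normE /= distrC => /ltW.
Qed.

Definition ulim (F : T -> R[i]) (l : R[i]) :=
  forall e : R, 0 < e -> \forall i \near U, normc (F i - l) <= e.

Lemma ultra_bounded_ulim (F : T -> R[i]) (M : R) :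
  (\forall i \near U, normc (F i) <= M) -> exists l, ulim F l.
Proof.
move=> FM.
have [p pP] := @ultra_bounded_real (fun i => complex.Re (F i)) M
  (filterS (fun i => le_trans (Re_le_normc (F i))) FM).
have [q qP] := @ultra_bounded_real (fun i => complex.Im (F i)) M
  (filterS (fun i => le_trans (Im_le_normc (F i))) FM).
exists (p +i* q) => e e0.
have e20 : 0 < e / 2 by rewrite divr_gt0.
near=> i; apply: le_trans (normc_le_ReIm _) _; rewrite reB imB /=.
have : `|complex.Re (F i) - p| <= e / 2 by near: i; exact: pP.
have : `|complex.Im (F i) - q| <= e / 2 by near: i; exact: qP.
lra.
Unshelve. all: by end_near. Qed.

Lemma ulim_unique (F : T -> R[i]) k l : ulim F k -> ulim F l -> k = l.
Proof.
move=> Fk Fl; apply/eqP; rewrite -subr_eq0; apply/eqP/eq0_normc/eqP.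
rewrite eq_le normc_ge0 andbT; apply/ler_addgt0Pl => e e0; rewrite addr0.
have e20 : 0 < e / 2 by rewrite divr_gt0.
have [i [ki li]] := filter_ex (filterI (Fk _ e20) (Fl _ e20)).
rewrite /= in ki li.
rewrite (_ : k - l = (F i - l) - (F i - k)); last by ring.
by apply: le_trans (le_normcD _ _) _; rewrite normcN; lra.
Qed.

Lemma ulim_le (F : T -> R[i]) l M : ulim F l ->
  (\forall i \near U, normc (F i) <= M) -> normc l <= M.
Proof.
move=> Fl FM; apply/ler_addgt0Pl => e e0.
have [i [ki li]] := filter_ex (filterI (Fl _ e0) FM); rewrite /= in ki li.
rewrite (_ : l = - (F i - l) + F i); last by ring.
by apply: le_trans (le_normcD _ _) _; rewrite normcN; exact: lerD.
Qed.

End UltraLimit.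

Section OneVariable.
Variable R : realType.
Implicit Types (a z w : R[i]) (f g h : R[i] -> R[i]) (r d M K : R).

Definition cdisk a r : set R[i] := [set z | normc (z - a) < r].

Lemma cdisk_center a r : 0 < r -> cdisk a r a.
Proof. by rewrite /cdisk /= subrr normc0. Qed.

Lemma cdisk_sub a r b s : normc (b - a) + s <= r -> cdisk b s `<=` cdisk a r.
Proof.
move=> abr z; rewrite /cdisk /= => zb.
rewrite (_ : z - a = (z - b) + (b - a)); last by ring.
apply: le_lt_trans (le_normcD _ _) _; rewrite addrC (lt_le_trans _ abr)//.
by rewrite ltrD2l.
Qed.

Lemma cdisk_line a r w z (t : R) : cdisk a r w -> cdisk a r z -> 0 <= t <= 1 ->
  cdisk a r (w + t%:C * (z - w)).
Proof.
rewrite /cdisk /= => wa za /andP[t0 t1].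
rewrite (_ : w + _ - a = (1 - t)%:C * (w - a) + t%:C * (z - a)); last first.
  by rewrite rmorphB rmorph1; ring.
apply: le_lt_trans (le_normcD _ _) _; rewrite !normcM !normc_real.
rewrite !ger0_norm ?subr_ge0//.
(* Strictness comes from the summand with coefficient [1 - t], which vanishes at [t = 1]. *)
have [->|tn1] := eqVneq t 1; first by rewrite subrr mul0r add0r mul1r.
rewrite (_ : r = (1 - t) * r + t * r); last by ring.
apply: ltr_leD; last by rewrite ler_wpM2l// ltW.
by rewrite ltr_pM2l// subr_gt0 lt_neqAle tn1.
Qed.

(** The factor 2 arises because the real mean value theorem gives different intermediate points for
    the two parts. *)
Lemma mean_value_bound f K w z :
  (forall t : R, 0 <= t <= 1 -> differentiable f (w + t%:C * (z - w)) /\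
     normc (derive1 f (w + t%:C * (z - w))) <= K) ->
  normc (f z - f w) <= 2 * K * normc (z - w).
Proof.
move=> H.
have P t : 0 <= t <= 1 -> _ :=
  fun tP => is_derive_line (differentiable_is_derive (proj1 (H t tP))).
have cont (p : R -> R) (t l : R) : is_derive t 1 p l -> {for t, continuous p}.
  by move=> [df _]; apply: differentiable_continuous; exact/derivable1_diffP.
have E0 : w + 0%:C * (z - w) = w by rewrite rmorph0; ring.
have E1 : w + 1%:C * (z - w) = z by rewrite rmorph1; ring.
have bnd (p : R -> R) (q : R -> R) :
    (forall t : R, 0 <= t <= 1 -> is_derive t 1 p (q t)) ->
    (forall t : R, 0 <= t <= 1 -> `|q t| <= K * normc (z - w)) ->
    `|p 1 - p 0| <= K * normc (z - w).
  move=> pq qK; have [|||c c01 ->] := @MVT R p q 0 1.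
  - exact: ltr01.
  - by move=> x; rewrite in_itv /= => /andP[/ltW x0 /ltW x1]; apply: pq; rewrite x0.
  - apply: continuous_in_subspaceT => x; rewrite inE /= in_itv /= => /pq; exact: cont.
  rewrite subr0 mulr1; apply: qK.
  by move: c01; rewrite in_itv /= => /andP[/ltW -> /ltW ->].
apply: le_trans (normc_le_ReIm _) _.
rewrite -mulrA mulrDl !mul1r reB imB; apply: lerD.
- have := bnd (fun s => complex.Re (f (w + s%:C * (z - w)))) _ (fun t tP => proj1 (P t tP)).
  rewrite E0 E1; apply => t tP; apply: le_trans (Re_le_normc _) _.
  by rewrite normcM ler_wpM2r ?normc_ge0//; have [] := H t tP.
- have := bnd (fun s => complex.Im (f (w + s%:C * (z - w)))) _ (fun t tP => proj2 (P t tP)).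
  rewrite E0 E1; apply => t tP; apply: le_trans (Im_le_normc _) _.
  by rewrite normcM ler_wpM2r ?normc_ge0//; have [] := H t tP.
Qed.

Lemma mean_bound f a d r M : 0 < r -> r < d -> holomorphic_on (cdisk a d) f ->
  (forall z, normc (z - a) = r -> normc (f z) <= M) -> normc (f a) <= 2 * M.
Proof.
move=> r0 rd fh fM; apply: (punctured_mean_bound r0 rd) fM.
  by apply: differentiable_continuous; apply: fh; exact/cdisk_center/(lt_trans r0).
by move=> z /andP[_ zd]; exact: fh.
Qed.

Lemma differentiable_near f g z : (\forall w \near z, f w = g w) ->
  differentiable f z -> differentiable g z.
Proof.
move=> fg /derivable1_diffP fd; apply/derivable1_diffP.
by apply: near_eq_derivable fg fd; rewrite oner_eq0.
Qed.

Lemma near_neq a z : z != a -> \forall w \near z, w != a.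
Proof.
move=> za; apply/nbhs_normcP; exists (normc (a - z)).
  by rewrite normc_gt0 subr_eq0 eq_sym.
by move=> w; apply: contraTneq => ->; rewrite ltxx.
Qed.

(** The difference quotient, completed by the derivative at [a], is continuous there and at most
    [2 * M / r] on the circle of radius [r < d]; [punctured_mean_bound] doubles this, and [r] tends
    to [d]. *)
Lemma cauchy_estimate f a d M : 0 < d -> holomorphic_on (cdisk a d) f ->
  (forall z, cdisk a d z -> normc (f z) <= M) ->
  normc (derive1 f a) <= 4 * M / d.
Proof.
move=> d0 fh fM.
have fa := differentiable_is_derive (fh a (cdisk_center a d0)).
pose g z := if z == a then derive1 f a else (f z - f a) / (z - a).
rewrite ler_pdivlMr//.
suff H r : 0 < r -> r < d -> normc (derive1 f a) * r <= 4 * M.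
  have [f0|f0] := leP (normc (derive1 f a)) 0.
    rewrite (le_trans (ler_wpM2r (ltW d0) f0))// mul0r mulr_ge0//.
    by apply: le_trans (normc_ge0 _) (fM a (cdisk_center a d0)).
  rewrite mulrC -ler_pdivlMr//; apply/ler_addgt0Pl => e e0.
  have [ed|de] := leP d e.
    rewrite (le_trans ed)// lerDl divr_ge0 ?(ltW f0)// mulr_ge0//.
    by apply: le_trans (normc_ge0 _) (fM a (cdisk_center a d0)).
  rewrite -lerBlDl ler_pdivlMr// mulrC; apply: H; first by rewrite subr_gt0.
  by rewrite ltrBlDr ltrDl.
move=> r0 rd; rewrite -ler_pdivlMr// (_ : 4 * M / r = 2 * (2 * M / r)); last ring.
have -> : derive1 f a = g a by rewrite /g eqxx.
apply: (punctured_mean_bound r0 rd).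
- apply/continuous_normcP => e e0.
  have /is_derive_normcP/(_ e e0)[dl dl0 dlP] := fa.
  exists dl => // z zdl; rewrite /g eqxx; case: eqVneq => [_|za].
    by rewrite subrr normc0 ltW.
  have z0 : z - a != 0 by rewrite subr_eq0.
  rewrite (_ : _ - _ = (f z - f a - derive1 f a * (z - a)) / (z - a)); last first.
    by rewrite [RHS]mulrBl; congr (_ - _); rewrite mulfK.
  by rewrite normcM normcV ler_pdivrMr ?normc_gt0// dlP.
- move=> z /andP[za zd]; have zNa : z != a by rewrite -subr_eq0 -normc_gt0.
  have : differentiable (fun w => (f w - f a) / (w - a)) z.
    apply: differentiableM.
      by apply: differentiableB; [exact: fh | exact: differentiable_cst].
    apply: differentiableV; last by rewrite subr_eq0.
    by apply: differentiableB => //; exact: differentiable_cst.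
  apply: differentiable_near.
  by apply: filterS (near_neq zNa) => w wa; rewrite /g (negbTE wa).
- move=> z zr; have zNa : z != a by rewrite -subr_eq0 -normc_gt0 zr.
  rewrite /g (negbTE zNa) normcM normcV zr ler_pM2r ?invr_gt0//.
  apply: le_trans (le_normcD _ _) _; rewrite normcN mulrDl mul1r lerD//.
    by apply: fM; rewrite /cdisk /= zr.
  exact: fM _ (cdisk_center a d0).
Qed.

End OneVariable.

(** * First-order Taylor bound and limits of holomorphic functions *)

Section OneVariable.
Variable R : realType.
Implicit Types (a z w : R[i]) (f g h : R[i] -> R[i]) (r d M K : R).

Lemma is_derive_translate f z c l : is_derive (z + c) 1 f l ->
  is_derive z 1 (fun w => f (w + c)) l.
Proof.
move=> /is_derive_normcP fl; apply/is_derive_normcP => e /fl[d d0 dP].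
exists d => // w wz; have := dP (w + c).
by rewrite (_ : w + c - (z + c) = w - z); [exact | ring].
Qed.

Lemma normc_lineB (w z : R[i]) (t : R) : 0 <= t <= 1 ->
  normc (w + t%:C * (z - w) - w) <= normc (z - w).
Proof.
move=> /andP[t0 t1]; rewrite addrC addKr normcM normc_real ger0_norm//.
by rewrite ler_piMl// normc_ge0.
Qed.

Section Bounded.
Variables (f : R[i] -> R[i]) (a : R[i]) (d M : R).
Hypotheses (d0 : 0 < d) (fh : holomorphic_on (cdisk a d) f).
Hypothesis fM : forall z, cdisk a d z -> normc (f z) <= M.

Let M0 : 0 <= M.
Proof. exact: le_trans (normc_ge0 _) (fM (cdisk_center a d0)). Qed.

(** Discs of radius [d / 2] around the points of the segment stay in the domain, so the derivative
    is at most [8 * M / d]; the mean value bound doubles it. *)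
Lemma holomorphic_lipschitz z w : cdisk a (d / 2) z -> cdisk a (d / 2) w ->
  normc (f z - f w) <= 16 * M / d * normc (z - w).
Proof.
move=> za wa; rewrite (_ : 16 * M / d = 2 * (4 * M / (d / 2))); last first.
  by field; rewrite gt_eqF.
apply: mean_value_bound => t t01; have ta := cdisk_line wa za t01.
have sub : cdisk (w + t%:C * (z - w)) (d / 2) `<=` cdisk a d.
  apply: cdisk_sub; rewrite -[leRHS](@divfK _ 2)//.
  by move: ta; rewrite /cdisk /= => /ltW; lra.
split; first by apply/fh/sub/cdisk_center; rewrite divr_gt0.
apply: cauchy_estimate; first by rewrite divr_gt0.
- by move=> y /sub; exact: fh.
- by move=> y /sub; exact: fM.
Qed.

(** Cauchy's estimate for the increment [F], which is small by the Lipschitz bound. The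
    differentiability of [derive1 f] rests on this lemma, so a second derivative cannot be used
    here. *)
Lemma derive1_lipschitz p : cdisk a (d / 4) p ->
  normc (derive1 f p - derive1 f a) <= 256 * M / d ^+ 2 * normc (p - a).
Proof.
move=> pa; pose F z := f (z + (p - a)) - f z.
have d40 : 0 < d / 4 by rewrite divr_gt0.
have sub z : cdisk a (d / 4) z ->
    cdisk a (d / 2) z /\ cdisk a (d / 2) (z + (p - a)).
  move: pa; rewrite /cdisk /= => pa za; split; first by lra.
  rewrite (_ : z + (p - a) - a = (z - a) + (p - a)); last by ring.
  by apply: le_lt_trans (le_normcD _ _) _; lra.
have sub2 z : cdisk a (d / 2) z -> cdisk a d z by rewrite /cdisk /=; lra.
have Fd z : cdisk a (d / 4) z ->
    is_derive z 1 F (derive1 f (z + (p - a)) - derive1 f z).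
  move=> /sub[/sub2 z1 /sub2 z2]; apply: is_deriveB.
    by apply: is_derive_translate; apply: differentiable_is_derive; exact: fh.
  by apply: differentiable_is_derive; exact: fh.
have := @cauchy_estimate _ F a (d / 4) (16 * M / d * normc (p - a)) d40.
rewrite (is_derive_derive1 (Fd a (cdisk_center a d40))).
rewrite (_ : a + (p - a) = p); last by ring.
rewrite (_ : 256 * M / d ^+ 2 * normc (p - a) =
  4 * (16 * M / d * normc (p - a)) / (d / 4)); last by field; rewrite gt_eqF.
apply; first by move=> z /Fd; exact: is_derive_differentiable.
move=> z /sub[z1 z2]; have := holomorphic_lipschitz z2 z1.
by rewrite (_ : z + (p - a) - z = p - a); last by ring.
Qed.

(** The point is that the constant depends on [M] and [d] only, so the bound survives a pointwise
    limit of functions with a common bound. *)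
Lemma holomorphic_taylor1 z : cdisk a (d / 4) z ->
  normc (f z - f a - derive1 f a * (z - a)) <=
    512 * M / d ^+ 2 * normc (z - a) ^+ 2.
Proof.
move=> za; pose g w := f w - derive1 f a * w.
have d40 : 0 < d / 4 by rewrite divr_gt0.
have sub : cdisk a (d / 4) `<=` cdisk a d.
  by move=> w; rewrite /cdisk /=; have := d0; lra.
have gd w : cdisk a (d / 4) w -> is_derive w 1 g (derive1 f w - derive1 f a).
  move=> /sub wa; apply: is_deriveB.
    by apply: differentiable_is_derive; exact: fh.
  apply/is_derive_normcP => e e0; exists 1 => // y _.
  rewrite [X in normc X](_ : _ = 0); last by ring.
  by rewrite normc0 mulr_ge0 ?normc_ge0// ltW.
rewrite (_ : _ - _ = g z - g a); last by rewrite /g; ring.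
rewrite (_ : 512 * M / d ^+ 2 * normc (z - a) ^+ 2 =
    2 * (256 * M / d ^+ 2 * normc (z - a)) * normc (z - a)); last by ring.
apply: mean_value_bound => t t01.
have ta := cdisk_line (cdisk_center a d40) za t01.
split; first exact: is_derive_differentiable (gd _ ta).
rewrite (is_derive_derive1 (gd _ ta)).
apply: le_trans (derive1_lipschitz ta) _.
apply: ler_wpM2l; last exact: normc_lineB.
apply: divr_ge0; last exact: exprn_ge0 (ltW d0).
by apply: mulr_ge0; [exact: ler0n | exact: M0].
Qed.

End Bounded.

Lemma taylor1_is_derive f a l d K : 0 < d ->
  (forall z, cdisk a d z ->
     normc (f z - f a - l * (z - a)) <= K * normc (z - a) ^+ 2) ->
  is_derive a 1 f l.
Proof.
move=> d0 H; apply/is_derive_normcP => e e0.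
have K0 : 0 < `|K| + 1 by rewrite ltr_wpDl.
exists (Num.min d (e / (`|K| + 1))); first by rewrite lt_min d0 divr_gt0.
move=> z; rewrite lt_min ltr_pdivlMr// => /andP[zd ze].
apply: le_trans (H z zd) _; rewrite expr2 mulrA ler_wpM2r ?normc_ge0//.
apply: le_trans (ltW ze); rewrite mulrC ler_wpM2l ?normc_ge0//.
by rewrite (le_trans (ler_norm K))// lerDl.
Qed.

(** Cauchy's estimate bounds the derivatives at [a], so they have a limit [l]; the uniform Taylor
    bound passes to the limit and makes [l] the derivative of [f]. *)
Lemma ulim_differentiable (T : Type) (U : set_system T) (UU : UltraFilter U)
    (F : T -> R[i] -> R[i]) f a d M : 0 < d ->
  (\forall i \near U, holomorphic_on (cdisk a d) (F i)) ->
  (\forall i \near U, forall z, cdisk a d z -> normc (F i z) <= M) ->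
  (forall z, cdisk a d z -> ulim U (F ^~ z) (f z)) ->
  differentiable f a.
Proof.
move=> d0 Fh FM Ff.
have [l Fl] : exists l, ulim U (fun i => derive1 (F i) a) l.
  apply: (@ultra_bounded_ulim _ _ _ _ _ (4 * M / d)).
  by apply: filterS2 Fh FM => i ih iM; exact: cauchy_estimate.
apply: (@is_derive_differentiable _ _ _ l).
apply: (@taylor1_is_derive f a l (d / 4) (512 * M / d ^+ 2)).
  by rewrite divr_gt0.
move=> z za; have zd : cdisk a d z by move: za; rewrite /cdisk /=; have := d0; lra.
apply: (@ulim_le _ _ _ UU (fun i => F i z - F i a - derive1 (F i) a * (z - a))).
  move=> e e0; set N := normc (z - a); have N0 : 0 <= N := normc_ge0 _.
  (* Three errors are added: two with weight 1 and that of the derivative with weight [N]. *)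
  have c0 : 0 < e / (2 + N) by rewrite divr_gt0// ltr_wpDr.
  have H1 := Ff z zd _ c0; have H2 := Ff a (cdisk_center a d0) _ c0.
  have H3 := Fl _ c0; near=> i.
  have h1 : normc (F i z - f z) <= e / (2 + N) by near: i.
  have h2 : normc (F i a - f a) <= e / (2 + N) by near: i.
  have h3 : normc (derive1 (F i) a - l) <= e / (2 + N) by near: i.
  rewrite (_ : _ - _ = (F i z - f z) - (F i a - f a)
      - (derive1 (F i) a - l) * (z - a)); last by ring.
  have -> : e = e / (2 + N) + e / (2 + N) + e / (2 + N) * N.
    by field; rewrite gt_eqF// ltr_wpDr.
  apply: le_trans (le_normcD _ _) _; rewrite normcN normcM -/N.
  apply: lerD; last by rewrite ler_wpM2r.
  by apply: le_trans (le_normcD _ _) _; rewrite normcN; exact: lerD.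
by apply: filterS2 Fh FM => i ih iM; exact: holomorphic_taylor1.
Unshelve. all: by end_near. Qed.

(** It turns the limit of difference quotients as [t] tends to 0 into one to which
    [ulim_differentiable] applies. *)
Lemma dnbhs_ultra : exists U : set_system R[i], UltraFilter U /\
  forall d, 0 < d -> \forall t \near U, t != 0 /\ normc t < d.
Proof.
have [U [UU sU]] := ultraFilterLemma (@Proper_dnbhs_numFieldType R[i] 0).
exists U; split=> // d d0; apply: sU; apply/nbhs_normcP.
by exists d => // z; rewrite subr0.
Qed.

(* The partial derivative is a pointwise limit of difference quotients, which
   are holomorphic in [s] and uniformly bounded by the Cauchy estimates. *)
Lemma differentiable_partial (Phi : R[i] -> R[i] -> R[i]) d M : 0 < d ->
  (forall s t, cdisk 0 d s -> cdisk 0 d t ->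
    [/\ differentiable (Phi ^~ t) s, differentiable (Phi s) t
      & normc (Phi s t) <= M]) ->
  differentiable (fun s => derive1 (Phi s) 0) 0.
Proof.
move=> d0 H; have [U [UU Ud]] := dnbhs_ultra.
have c0 := cdisk_center 0 d0.
have d20 : 0 < d / 2 by rewrite divr_gt0.
pose F t s := (Phi s t - Phi s 0) / t.
apply: (@ulim_differentiable _ U UU F _ 0 d (16 * M / d)) => //.
- apply: filterS (Ud d d0) => t [tN0 td] s sd.
  have td' : cdisk 0 d t by rewrite /cdisk /= subr0.
  have [h1 _ _] := H s t sd td'; have [h2 _ _] := H s 0 sd c0.
  exact: differentiableM (differentiableB h1 h2) (differentiable_cst _ _).
- apply: filterS (Ud _ d20) => t [tN0 td] s sd.
  rewrite /F normcM normcV ler_pdivrMr ?normc_gt0//.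
  have h1 : holomorphic_on (cdisk 0 d) (Phi s) by move=> y yd; have [] := H s y sd yd.
  have h2 y : cdisk 0 d y -> normc (Phi s y) <= M by move=> yd; have [] := H s y sd yd.
  have td' : cdisk 0 (d / 2) t by rewrite /cdisk /= subr0.
  have := holomorphic_lipschitz d0 h1 h2 td' (cdisk_center 0 d20).
  by rewrite subr0.
- move=> s sd e e0.
  have /differentiable_is_derive/is_derive_normcP/(_ e e0)[dl dl0 dlP] :
    differentiable (Phi s) 0 by have [] := H s 0 sd c0.
  apply: filterS (Ud _ dl0) => t [tN0 tdl].
  have := dlP t; rewrite subr0 => /(_ tdl).
  rewrite -ler_pdivrMr ?normc_gt0// -normcV -normcM.
  by rewrite mulrBl mulfK.
Qed.

Lemma locally_bounded f a : differentiable f a ->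
  exists2 d, 0 < d & forall z, cdisk a d z -> normc (f z) <= normc (f a) + 1.
Proof.
move=> /differentiable_continuous/continuous_normcP/(_ 1 ltr01)[d d0 dP].
exists d => // z /dP H; rewrite -[f z](subrK (f a)) addrC.
by apply: le_trans (le_normcD _ _) _; rewrite lerD2l.
Qed.

(** The derivative at [s + a] is the partial derivative in [t] at 0 of [f (t + (s + a))], so
    [differentiable_partial] applies. *)
Lemma differentiable_derive1 f a d : 0 < d -> holomorphic_on (cdisk a d) f ->
  differentiable (derive1 f) a.
Proof.
move=> d0 fh.
have [r r0 rM] := locally_bounded (fh a (cdisk_center a d0)).
(* Half the minimum, since the two variables are added and [t + s] must stay where [f] is both
   holomorphic and bounded. *)
pose q := Num.min d r / 2.
have qd : 2 * q <= d by rewrite /q mulrC divfK// ge_min lexx.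
have qr : 2 * q <= r by rewrite /q mulrC divfK// ge_min lexx orbT.
have q0 : 0 < q by rewrite divr_gt0// lt_min d0.
have H : differentiable (fun s => derive1 (fun t => f (t + (s + a))) 0) 0.
  have sub s t : cdisk 0 q s -> cdisk 0 q t -> normc (t + (s + a) - a) < 2 * q.
    rewrite /cdisk /= !subr0 => sq tq; rewrite addrA addrK.
    by apply: le_lt_trans (le_normcD _ _) _; lra.
  apply: (@differentiable_partial (fun s t => f (t + (s + a))) q
    (normc (f a) + 1) q0) => s t sq tq.
  have fd := fh _ (lt_le_trans (sub _ _ sq tq) qd).
  split; last exact: rM (lt_le_trans (sub _ _ sq tq) qr).
  - have := is_derive_translate (c := t + a) (z := s) (f := f).
    rewrite (_ : s + (t + a) = t + (s + a)); last by ring.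
    move=> /(_ _ (differentiable_is_derive fd))/is_derive_differentiable.
    by under eq_fun do rewrite addrCA.
  - have := is_derive_translate (c := s + a) (z := t) (f := f).
    by move=> /(_ _ (differentiable_is_derive fd))/is_derive_differentiable.
have E : \forall s \near 0, derive1 (fun t => f (t + (s + a))) 0 = derive1 f (s + a).
  apply/nbhs_normcP; exists d; first exact: d0.
  move=> s; rewrite subr0 => sd.
  apply: is_derive_derive1; apply: is_derive_translate.
  rewrite add0r; apply: differentiable_is_derive.
  by apply: fh; rewrite /cdisk /= addrK.
have {}H := differentiable_near E H.
have := @is_derive_translate (fun s => derive1 f (s + a)) a (- a).
rewrite subrr => /(_ _ (differentiable_is_derive H))/is_derive_differentiable.
by under eq_fun do rewrite subrK.
Qed.

End OneVariable.

(** * Zeros of holomorphic functions *)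

Section Hurwitz.
Variable R : realType.
Implicit Types (a z w : R[i]) (f g h : R[i] -> R[i]) (r d M : R).

(** At [a] the quotient has derivative [f''(a) / 2]. The factorisation holds at every [z], even off
    the disc, which makes the lemma easy to iterate. *)
Lemma holomorphic_division f a d : 0 < d -> holomorphic_on (cdisk a d) f ->
  f a = 0 -> exists2 g, holomorphic_on (cdisk a d) g &
    forall z, f z = (z - a) * g z.
Proof.
move=> d0 fh fa0.
pose g z := if z == a then derive1 f a else f z / (z - a).
exists g; last first.
  move=> z; rewrite /g; have [->|za] := eqVneq z a; first by rewrite subrr mul0r.
  by rewrite mulrCA divff ?mulr1// subr_eq0.
move=> z zd; have [->|za] := eqVneq z a; last first.
  have : differentiable (fun w => f w / (w - a)) z.
    apply: (@differentiableM _ _ f (fun w => (w - a)^-1)); first exact: fh.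
    apply: differentiableV; last by rewrite subr_eq0.
    by apply: differentiableB => //; exact: differentiable_cst.
  apply: differentiable_near.
  by apply: filterS (near_neq za) => w wa; rewrite /g (negbTE wa).
have := differentiable_is_derive (differentiable_derive1 d0 fh).
set c := derive1 (derive1 f) a => /is_derive_normcP fc.
apply: (@is_derive_differentiable _ _ _ (c / 2)); apply/is_derive_normcP => e e0.
have [|r r0 rP] := fc (e / 2); first by rewrite divr_gt0.
exists (Num.min d r); first by rewrite lt_min d0.
move=> w; rewrite lt_min => /andP[wd wr]; rewrite /g eqxx.
have [->|wa] := eqVneq w a; first by rewrite !subrr mulr0 subr0 normc0 mulr0.
have w0 : w - a != 0 by rewrite subr_eq0.
(* The second-order Taylor remainder: its derivative is small compared with [v - a], so its
   increment from [a] is small compared with the square. *)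
pose p v := f v - derive1 f a * (v - a) - c / 2 * (v - a) ^+ 2.
have pd v : cdisk a d v -> is_derive v 1 p (derive1 f v - derive1 f a - c * (v - a)).
  move=> vd; apply: is_deriveB; first apply: is_deriveB.
  - exact/differentiable_is_derive/fh.
  - apply/is_derive_normcP => e1 e10; exists 1 => // y _.
    rewrite [X in normc X](_ : _ = 0); last by ring.
    by rewrite normc0 mulr_ge0 ?normc_ge0// ltW.
  - apply: (@taylor1_is_derive _ _ _ _ 1 (normc (c / 2))) => // y _.
    rewrite -normcX -normcM le_eqVlt; apply/orP; left; apply/eqP; congr normc.
    by field.
have pw : normc (p w - p a) <= 2 * (e / 2 * normc (w - a)) * normc (w - a).
  apply: mean_value_bound => t t01.
  have ta := cdisk_line (cdisk_center a d0) wd t01.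
  split; first exact: is_derive_differentiable (pd _ ta).
  rewrite (is_derive_derive1 (pd _ ta)).
  have tw := normc_lineB a w t01.
  apply: le_trans (rP _ (le_lt_trans tw wr)) _.
  by rewrite ler_wpM2l// divr_ge0// ltW.
rewrite -(ler_pM2r (_ : 0 < normc (w - a))) ?normc_gt0//.
rewrite -normcM [X in normc X](_ : _ = p w - p a).
  by apply: le_trans pw _; rewrite mulrA [2 * _]mulrC divfK.
by rewrite /p fa0; field.
Qed.

(** A closed part of the image of a square under the continuous map [(x, y) |-> x +i* y]. *)
Lemma closed_cdisk_compact a r : compact [set z | normc (z - a) <= r].
Proof.
pose F (p : R * R) : R[i] := p.1 +i* p.2.
have Fc : continuous F.
  move=> p; apply/(@cvgrPdist_lt _ _ _ (nbhs p)) => e e0.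
  have eE : e = (complex.Re e)%:C by rewrite RRe_real// gtr0_real.
  have e20 : 0 < complex.Re e / 2 by rewrite divr_gt0// -ltcR -eE.
  apply: filterS (nbhsx_ballx p _ e20) => q [].
  rewrite -!ball_normE /= => q1 q2; rewrite normr_normc eE ltcR.
  apply: le_lt_trans (normc_sub_le _ _ _ _) _.
  by rewrite [ltRHS](splitr (complex.Re e)) ltrD.
have cI : compact (F @` (`[complex.Re a - r, complex.Re a + r] `*`
    `[complex.Im a - r, complex.Im a + r])).
  apply: continuous_compact; first exact: continuous_subspaceT.
  by apply: compact_setX; exact: segment_compact.
apply: subclosed_compact cI _.
  rewrite closedE => z /= nz; rewrite leNgt; apply/negP => rz; apply: nz.
  apply/nbhs_normcP; exists (normc (z - a) - r); first by rewrite subr_gt0.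
  move=> w wz; apply/negP; rewrite -ltNge.
  have : normc (z - a) <= normc (z - w) + normc (w - a).
    by rewrite (_ : z - a = (z - w) + (w - a)); [exact: le_normcD | ring].
  by rewrite normcB in wz; lra.
move=> z /= za; exists (complex.Re z, complex.Im z); last by case: (z).
have := le_trans (Re_le_normc _) za; have := le_trans (Im_le_normc _) za.
rewrite reB imB !ler_norml => /andP[h1 h2] /andP[h3 h4].
by split; rewrite /= in_itv /=; apply/andP; split; lra.
Qed.

Lemma normc_continuous a : continuous (fun z : R[i] => normc (z - a)).
Proof.
move=> z; apply/(@cvgrPdist_le _ _ _ (nbhs z)) => e e0.
apply/nbhs_normcP; exists e => // w /ltW wz.
apply: le_trans wz; rewrite ler_norml.
have : normc (z - a) <= normc (w - z) + normc (w - a).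
  by rewrite (normcB w z) (_ : z - a = (z - w) + (w - a)); [exact: le_normcD | ring].
have : normc (w - a) <= normc (w - z) + normc (z - a).
  by rewrite {1}(_ : w - a = (w - z) + (z - a)); [exact: le_normcD | ring].
by move=> h1 h2; apply/andP; split; lra.
Qed.

Lemma normc_comp_continuous f z :
  {for z, continuous f} -> {for z, continuous (fun w => normc (f w))}.
Proof.
move=> fz; have E : (fun w => normc (f w)) = (fun w => normc (w - 0)) \o f.
  by apply/funext => w; rewrite /comp subr0.
by rewrite E; apply: continuous_comp fz _; exact: normc_continuous.
Qed.

Lemma circle_compact a r : compact [set z | normc (z - a) = r].
Proof.
apply: (subclosed_compact _ (@closed_cdisk_compact a r)).
  have := @closed_comp _ _ _ _ (fun z _ => @normc_continuous a z) (@closed_eq _ r).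
  exact.
by move=> z /= ->.
Qed.

(* All divisions by [z - a] are possible, so [h z = (z - a) ^+ N * k z] for every
   [N]; the mean bound for [k] on the circle of centre [z] and radius
   [3 * normc (z - a)] gives [normc (h z) <= 2 * M / 2 ^+ N]. *)
Lemma zero_on_circles h a d M : holomorphic_on (cdisk a d) h ->
  (forall z, cdisk a d z -> normc (h z) <= M) ->
  (forall r, 0 < r < d -> exists2 z, normc (z - a) = r & h z = 0) ->
  forall z, cdisk a (d / 4) z -> h z = 0.
Proof.
move=> hh hM h0 z; rewrite /cdisk /= => zd.
have d0 : 0 < d.
  by have := normc_ge0 (z - a); have := zd; lra.
have M0 : 0 <= M := le_trans (normc_ge0 _) (hM a (cdisk_center a d0)).
have key N : exists2 k, holomorphic_on (cdisk a d) k &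
    forall w, h w = (w - a) ^+ N * k w.
  elim: N => [|N [k kh kE]]; first by exists h => // w; rewrite expr0 mul1r.
  (* Otherwise [k] would have no zero near [a]; but it vanishes wherever [h] does off [a], in
     particular somewhere on a small circle. *)
  have ka0 : k a = 0.
    apply/eqP; apply: contrapT => /negP kaN0.
    have /continuous_normcP/(_ (normc (k a) / 2)) :=
      differentiable_continuous (kh a (cdisk_center a d0)).
    case; first by rewrite divr_gt0// normc_gt0.
    move=> r r0 rP.
    pose q := Num.min d r / 2.
    have q0 : 0 < q by rewrite divr_gt0// lt_min d0.
    have qm : q < Num.min d r.
      by rewrite ltr_pdivrMr// ltr_pMr ?ltr1n// lt_min d0.
    have qd : q < d.
      by rewrite (lt_le_trans qm)// ge_min lexx.
    have qr : q < r.
      by rewrite (lt_le_trans qm)// ge_min lexx orbT.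
    have [|w wq hw] := h0 q; first by rewrite q0.
    have wa : w - a != 0 by rewrite -normc_gt0 wq.
    have kw : k w = 0.
      by move/eqP: hw; rewrite kE mulf_eq0 expf_eq0 (negbTE wa) andbF => /eqP.
    have := rP w; rewrite wq => /(_ qr); rewrite kw sub0r normcN.
    have : 0 < normc (k a) by rewrite normc_gt0.
    lra.
  have [g gh gE] := holomorphic_division d0 kh ka0.
  by exists g => // w; rewrite kE gE exprSr mulrA.
have [->|za] := eqVneq z a.
  have [k _ kE] := key 1%N; by rewrite kE subrr expr1 mul0r.
set s := normc (z - a) in zd *; have s0 : 0 < s by rewrite normc_gt0 subr_eq0.
have bound N : normc (h z) <= 2 * M * (2^-1) ^+ N.
  have [k kh kE] := key N.
  have sub : cdisk z (d - s) `<=` cdisk a d by apply: cdisk_sub; rewrite addrC subrK.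
  (* Points at distance [3 * s] from [z] are at least [2 * s] from [a], twice as far as [z], hence
     the ratio [2 ^- N]; [s < d / 4] keeps the circle in the disc. *)
  have kz : normc (k z) <= 2 * (M / (2 * s) ^+ N).
    apply: (@mean_bound _ k z (d - s) (3 * s)).
    - by rewrite mulr_gt0.
    - lra.
    - by move=> w /sub; exact: kh.
    - move=> w w3.
      have wa : 2 * s <= normc (w - a).
        have : normc (w - z) <= normc (w - a) + normc (z - a).
          rewrite (normcB z) (_ : w - z = (w - a) + (a - z)); last by ring.
          exact: le_normcD.
        by rewrite w3 -/s; lra.
      have wd : cdisk a d w by apply: sub; rewrite /cdisk /= w3; lra.
      rewrite ler_pdivlMr; last by rewrite exprn_gt0// mulr_gt0.
      apply: le_trans (hM w wd); rewrite kE normcM normcX mulrC ler_wpM2r ?normc_ge0//.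
      by apply: lerXn2r; rewrite ?nnegrE ?normc_ge0// mulr_ge0// ltW.
  rewrite kE normcM normcX -/s.
  apply: le_trans (ler_wpM2l (exprn_ge0 _ (ltW s0)) kz) _.
  rewrite exprMn exprVn le_eqVlt; apply/orP; left; apply/eqP.
  by field; rewrite !expf_neq0// gt_eqF.
apply: eq0_normc; apply/eqP; rewrite eq_le normc_ge0 andbT.
apply/ler_addgt0Pl => e e0; rewrite addr0.
have : (fun N => 2 * M * (2^-1 : R) ^+ N) @ \oo --> 2 * M * 0.
  apply: cvgM; first exact: cvg_cst.
  by apply: cvg_expr; rewrite ger0_norm ?invr_ge0// invf_lt1// ltr1n.
rewrite mulr0 => /cvgrPdist_le /(_ _ e0)[N _ /(_ N (leqnn N))] /=.
rewrite sub0r normrN => Ne; apply: le_trans (bound N) (le_trans (ler_norm _) Ne).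
Qed.

End Hurwitz.

Section UltraHurwitz.
Variables (R : realType) (T : Type) (U : set_system T).
Context {UU : UltraFilter U}.
Implicit Types (a z w x : R[i]) (F : T -> R[i] -> R[i]) (h : R[i] -> R[i]).
Implicit Types (r d M L : R).

Lemma ulim_lipschitz F h x d L :
  (\forall i \near U, forall z w, cdisk x d z -> cdisk x d w ->
     normc (F i z - F i w) <= L * normc (z - w)) ->
  (forall z, cdisk x d z -> ulim U (F ^~ z) (h z)) ->
  forall z w, cdisk x d z -> cdisk x d w ->
    normc (h z - h w) <= L * normc (z - w).
Proof.
move=> FL Fh z w zx wx; apply: (@ulim_le _ _ _ UU (fun i => F i z - F i w)).
  move=> e e0; have e20 : 0 < e / 2 by rewrite divr_gt0.
  apply: filterS2 (Fh z zx _ e20) (Fh w wx _ e20) => i iz iw.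
  rewrite (_ : _ - _ = (F i z - h z) - (F i w - h w)); last by ring.
  by apply: le_trans (le_normcD _ _) _; rewrite normcN (splitr e) lerD.
by apply: filterS FL => i; apply.
Qed.

(** An [e / 3] argument with the common Lipschitz constant. The conclusion near the pair of [x] and
    [U] is the form that compactness as near covering consumes. *)
Lemma ulim_locally_uniform F h x d L : 0 < d ->
  (\forall i \near U, forall z w, cdisk x d z -> cdisk x d w ->
     normc (F i z - F i w) <= L * normc (z - w)) ->
  (forall z, cdisk x d z -> ulim U (F ^~ z) (h z)) ->
  forall e : R, 0 < e -> \forall z \near x & i \near U, normc (F i z - h z) <= e.
Proof.
move=> d0 FL Fh e e0; have hL := ulim_lipschitz FL Fh.
have L0 : 0 < `|L| + 1 by rewrite ltr_wpDl.
pose r := Num.min d (e / 3 / (`|L| + 1)).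
have r0 : 0 < r by rewrite lt_min d0 !divr_gt0.
have e30 : 0 < e / 3 by rewrite divr_gt0.
have xx := cdisk_center x d0.
exists (cdisk x r, [set i | normc (F i x - h x) <= e / 3 /\
    forall z w, cdisk x d z -> cdisk x d w ->
     normc (F i z - F i w) <= L * normc (z - w)]).
  split; first by apply/nbhs_normcP; exists r.
  by apply: filterI FL; exact: Fh.
move=> [z i] /= [zr [ix iL]].
have zd : cdisk x d z.
  by move: zr; rewrite /cdisk /= => /lt_le_trans; apply; rewrite ge_min lexx.
have zL : L * normc (z - x) <= e / 3.
  apply: (@le_trans _ _ ((`|L| + 1) * normc (z - x))).
    by rewrite ler_wpM2r ?normc_ge0// (le_trans (ler_norm L))// lerDl.
  rewrite mulrC -ler_pdivlMr//; move: zr; rewrite /cdisk /= => /ltW/le_trans; apply.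
  by rewrite ge_min lexx orbT.
rewrite (_ : _ - _ = (F i z - F i x) + (F i x - h x) - (h z - h x)); last by ring.
apply: le_trans (le_normcD _ _) _; rewrite normcN.
have := le_normcD (F i z - F i x) (F i x - h x).
by have := le_trans (iL z x zd xx) zL; have := le_trans (hL z x zd xx) zL; lra.
Qed.

Lemma ulim_hurwitz F h a d M : 0 < d ->
  (\forall i \near U, holomorphic_on (cdisk a d) (F i)) ->
  (\forall i \near U, forall z, cdisk a d z -> normc (F i z) <= M) ->
  (\forall i \near U, forall z, cdisk a d z -> F i z != 0) ->
  (forall z, cdisk a d z -> ulim U (F ^~ z) (h z)) ->
  h a = 0 -> forall z, cdisk a (d / 16) z -> h z = 0.
Proof.
move=> d0 Fh FM F0 Fl ha0.
have d20 : 0 < d / 2 by rewrite divr_gt0.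
have sub2 : cdisk a (d / 2) `<=` cdisk a d.
  by move=> z; rewrite /cdisk /=; have := d0; lra.
have FL : \forall i \near U, forall z w, cdisk a (d / 2) z -> cdisk a (d / 2) w ->
     normc (F i z - F i w) <= 16 * M / d * normc (z - w).
  by apply: filterS2 Fh FM => i ih iM z w; exact: holomorphic_lipschitz.
have hd z : cdisk a (d / 2) z -> differentiable h z.
  move=> za.
  have sub : cdisk z (d / 2) `<=` cdisk a d.
    by apply: cdisk_sub; move: za; rewrite /cdisk /=; lra.
  apply: (@ulim_differentiable _ _ _ UU F h z (d / 2) M) => //.
  - by apply: filterS Fh => i ih y /sub; exact: ih.
  - by apply: filterS FM => i iM y /sub; exact: iM.
  - by move=> y /sub; exact: Fl.
have sub4 : cdisk a (d / 4) `<=` cdisk a (d / 2).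
  by move=> z; rewrite /cdisk /=; have := d0; lra.
rewrite (_ : d / 16 = d / 4 / 4); last by field.
apply: (@zero_on_circles _ h a (d / 4) M).
- by move=> z /sub4; exact: hd.
- move=> z /sub4/sub2 za; apply: ulim_le (Fl z za) _.
  by apply: filterS FM => i; exact.
move=> r /andP[r0 rd]; apply: contrapT => hN0.
pose S := [set z : R[i] | normc (z - a) = r].
have SD : S `<=` cdisk a (d / 2) by move=> z /= zr; rewrite /cdisk /= zr; lra.
have [c cS cmin] : exists2 c, c \in S & forall t, t \in S ->
    normc (h c) <= normc (h t).
  apply: compact_EVT_min.
  - by exists (a + r%:C); rewrite /S /= addrC addKr normc_real gtr0_norm.
  - exact: circle_compact.
  apply: continuous_in_subspaceT => z; rewrite inE => /SD zd.
  exact: (normc_comp_continuous (differentiable_continuous (hd z zd))).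
rewrite inE in cS.
pose m := normc (h c).
have m0 : 0 < m.
  rewrite normc_gt0; apply/eqP => hc0; apply: hN0; exists c => //.
have m40 : 0 < m / 4 by rewrite divr_gt0.
(* Local uniformity and compactness of the circle give one set of indices for all its points. *)
have Fm : \forall i \near U, forall z, S z -> m / 2 <= normc (F i z).
  have /compact_near_coveringP/near_covering_withinP := @circle_compact R a r.
  apply => x xS.
  have xd : cdisk a (d / 2) x := SD x xS.
  have rx : 0 < d / 2 - r by lra.
  have sub : cdisk x (d / 2 - r) `<=` cdisk a (d / 2).
    by apply: cdisk_sub; rewrite [normc _]xS; lra.
  have FLx : \forall i \near U, forall z w, cdisk x (d / 2 - r) z ->
      cdisk x (d / 2 - r) w -> normc (F i z - F i w) <= 16 * M / d * normc (z - w).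
    by apply: filterS FL => i iL z w /sub zs /sub ws; exact: iL.
  have Flx z : cdisk x (d / 2 - r) z -> ulim U (F ^~ z) (h z).
    by move=> /sub/sub2; exact: Fl.
  apply: filterS (ulim_locally_uniform rx FLx Flx m40) => -[z i] /= zi zS.
  have zm : m <= normc (h z) by apply: cmin; rewrite inE.
  have : normc (h z) <= normc (F i z) + normc (F i z - h z).
    rewrite {1}(_ : h z = F i z - (F i z - h z)); last by ring.
    by apply: le_trans (le_normcD _ _) _; rewrite normcN.
  by move: m40; lra.
(* The mean bound will give [4 / m] for the inverse at [a]; times [m / 8] this is [1 / 2], while the
   product should be at least 1. *)
have m80 : 0 < m / 8 by rewrite divr_gt0.
have aa := cdisk_center a d0.
have Fa := Fl a aa _ m80; rewrite ha0 in Fa.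
have [i [iS [ia [ih i0]]]] := filter_ex (filterI Fm (filterI Fa (filterI Fh F0))).
rewrite /= subr0 in ia.
have : normc (F i a)^-1 <= 2 * (m / 2)^-1.
  have rd' : r < d by lra.
  apply: (@mean_bound _ (fun z => (F i z)^-1) a d r _ r0 rd').
    by move=> z zd; apply: differentiableV; [exact: ih | exact: i0].
  move=> z zr; have mz := iS z zr.
  have m20 : 0 < m / 2 by rewrite divr_gt0.
  by rewrite normcV lef_pV2// posrE (lt_le_trans m20).
have N0 : 0 < normc (F i a) by rewrite normc_gt0 i0.
rewrite normcV -[leLHS]mul1r ler_pdivrMr// => /le_trans.
have c0 : 0 <= 2 * (m / 2)^-1 by rewrite mulr_ge0// invr_ge0 ltW// divr_gt0.
move=> /(_ _ (ler_wpM2l c0 ia)).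
rewrite (_ : _ * (m / 8) = 1 / 2); last by field; rewrite gt_eqF.
lra.
Qed.

End UltraHurwitz.

(** * Marty's theorem *)

Section InverseSquare.
Variable R : realType.
Implicit Types (a z w : R[i]) (g : R[i] -> R[i]) (d K : R).

Definition sqinv z : R := (1 + normc z ^+ 2)^-1.

Lemma sqinv_gt0 z : 0 < sqinv z.
Proof. by rewrite invr_gt0 ltr_pwDl// exprn_ge0// normc_ge0. Qed.

Lemma sqinv_le1 z : sqinv z <= 1.
Proof.
rewrite invf_le1 ?lerDl ?exprn_ge0 ?normc_ge0//.
by rewrite ltr_pwDl// exprn_ge0// normc_ge0.
Qed.

(** With [s = 1 + |g|^2], the derivative of [1 / s] along the segment is at most [4 |g| |v| / s^2];
    then [2 |g| <= s] and [|v| <= K s |z - w|] leave [2 K |z - w|]. *)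
Lemma sqinv_lipschitz g a d K : holomorphic_on (cdisk a d) g ->
  (forall w, cdisk a d w -> normc (derive1 g w) <= K * (1 + normc (g w) ^+ 2)) ->
  forall z w, cdisk a d z -> cdisk a d w ->
    `|sqinv (g z) - sqinv (g w)| <= 2 * K * normc (z - w).
Proof.
move=> gh gK z w za wa.
pose p t := w + t%:C * (z - w).
have pa t : 0 <= t <= 1 -> cdisk a d (p t) := cdisk_line wa za.
pose x t := complex.Re (g (p t)); pose y t := complex.Im (g (p t)).
pose v t := derive1 g (p t) * (z - w).
pose s t := 1 + x t ^+ 2 + y t ^+ 2.
have sE t : s t = 1 + normc (g (p t)) ^+ 2 by rewrite /s sqr_normcE addrA.
have s0 t : 0 < s t by rewrite sE ltr_pwDl// exprn_ge0// normc_ge0.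
have xd (t : R) : 0 <= t <= 1 -> is_derive t 1 x (complex.Re (v t)) /\
    is_derive t 1 y (complex.Im (v t)).
  by move=> /pa/gh/differentiable_is_derive/is_derive_line.
have sd (t : R) : 0 <= t <= 1 -> is_derive t 1 (fun r => (s r)^-1)
   (- (s t) ^- 2 *: (2 * (x t * complex.Re (v t) + y t * complex.Im (v t)))).
  move=> t01; have [xt yt] := xd t t01.
  apply: is_deriveV; first by rewrite gt_eqF.
  have := is_deriveD (is_deriveD (is_derive_cst (1 : R) t 1) (is_deriveX 2 xt))
    (is_deriveX 2 yt).
  move/is_derive_eq; apply.
  rewrite /GRing.scale /= !expr1. ring.
have cont (q : R -> R) (t l : R) : is_derive t 1 q l -> {for t, continuous q}.
  by move=> [df _]; apply: differentiable_continuous; exact/derivable1_diffP.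
have [|||c c01] := @MVT R (fun r => (s r)^-1)
   (fun t => - (s t) ^- 2 *: (2 * (x t * complex.Re (v t) + y t * complex.Im (v t)))) 0 1.
- exact: ltr01.
- by move=> t; rewrite in_itv /= => /andP[/ltW t0 /ltW t1]; apply: sd; rewrite t0.
- apply: continuous_in_subspaceT => t; rewrite inE /= in_itv /= => /sd; exact: cont.
have {}c01 : 0 <= c <= 1 by move: c01; rewrite in_itv /= => /andP[/ltW -> /ltW ->].
have p1 : p 1 = z by rewrite /p rmorph1; ring.
have p0 : p 0 = w by rewrite /p rmorph0; ring.
rewrite (sE 1) (sE 0) p1 p0 -!/(sqinv _) => ->.
rewrite subr0 mulr1 normrZ normrN ger0_norm ?invr_ge0 ?exprn_ge0 ?(ltW (s0 c))//.
have nE (q : R) : `|2 * q| = 2 * `|q| by rewrite normrM ger0_norm.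
rewrite [leLHS]mulrC ler_pdivrMr ?exprn_gt0// nE.
have gn := normc_ge0 (g (p c)); have vn := normc_ge0 (v c).
have vK : normc (v c) <= K * s c * normc (z - w).
  by rewrite normcM ler_wpM2r ?normc_ge0// sE; exact/gK/pa.
have H : `|x c * complex.Re (v c) + y c * complex.Im (v c)| <=
    2 * (normc (g (p c)) * normc (v c)).
  apply: le_trans (ler_normD _ _) _; rewrite !normrM mulrDl mul1r.
  by apply: lerD; apply: ler_pM => //; rewrite ?Re_le_normc ?Im_le_normc.
apply: (@le_trans _ _ (2 * s c * normc (v c))).
  rewrite -mulrA ler_pM2l//; apply: le_trans H _; rewrite mulrA ler_wpM2r// sE.
  have := sqr_ge0 (1 - normc (g (p c))); rewrite sqrrB expr1n mul1r -mulr_natl; lra.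
rewrite expr2 (_ : 2 * K * _ * _ = 2 * s c * (K * s c * normc (z - w))); last by ring.
by rewrite ler_pM2l// mulr_gt0.
Qed.

End InverseSquare.

Section SphericalLimit.
Variables (R : realType) (u : nat -> R[i] -> R[i]) (U : set_system nat).
Context {UU : UltraFilter U}.
Implicit Types (a z w x : R[i]) (r d K L : R).

Let D := cdisk (0 : R[i]) 1.

Hypothesis uh : forall m, holomorphic_on D (u m).
Hypothesis uK : forall z, D z -> exists r K, [/\ 0 < r, cdisk z r `<=` D &
  forall m w, cdisk z r w ->
    normc (derive1 (u m) w) <= K * (1 + normc (u m w) ^+ 2)].

(** Embedded in [R[i]] so that the lemmas on [ulim] apply. *)
Let Q m z : R[i] := (sqinv (u m z))%:C.

Let normcQ m z : normc (Q m z) = sqinv (u m z).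
Proof. by rewrite normc_real gtr0_norm// sqinv_gt0. Qed.

Variable q : R[i] -> R[i].
Hypothesis Qq : forall z, ulim U (Q ^~ z) (q z).

Let Qlip z : D z -> exists r L, [/\ 0 < r, cdisk z r `<=` D &
  forall m x y, cdisk z r x -> cdisk z r y ->
    normc (Q m x - Q m y) <= L * normc (x - y)].
Proof.
move=> /uK[r [K [r0 rD rK]]]; exists r, (2 * K); split=> // m x y xr yr.
rewrite -rmorphB normc_real; apply: (sqinv_lipschitz _ (rK m)) xr yr.
by move=> w /rD; exact: uh.
Qed.

Let qunif z : D z -> forall e : R, 0 < e ->
  \forall x \near z & i \near U, normc (Q i x - q x) <= e.
Proof.
move=> /Qlip[r [L [r0 rD rL]]].
apply: (@ulim_locally_uniform _ _ _ UU Q q z r L r0) => //.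
by apply: filterE => i x y; exact: rL.
Qed.

Let qcont z : D z -> forall e : R, 0 < e -> \forall x \near z, normc (q x - q z) <= e.
Proof.
move=> /Qlip[r [L [r0 rD rL]]] e e0.
have qL : forall x y, cdisk z r x -> cdisk z r y ->
    normc (q x - q y) <= L * normc (x - y).
  apply: (@ulim_lipschitz _ _ _ UU Q q) => //.
  by apply: filterE => i x y; exact: rL.
have L0 : 0 < `|L| + 1 by rewrite ltr_wpDl.
apply/nbhs_normcP; exists (Num.min r (e / (`|L| + 1))).
  by rewrite lt_min r0 divr_gt0.
move=> x; rewrite lt_min ltr_pdivlMr// => /andP[xr xe].
apply: le_trans (qL x z xr (cdisk_center z r0)) _; apply: le_trans (ltW xe).
rewrite mulrC ler_wpM2l ?normc_ge0// (le_trans (ler_norm L))// lerDl.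
exact: ler01.
Qed.

Lemma finite_locally_bounded z : D z -> q z != 0 ->
  exists r M, [/\ 0 < r, cdisk z r `<=` D &
    \forall i \near U, forall w, cdisk z r w -> normc (u i w) <= M].
Proof.
move=> zD qz; set c := normc (q z); have c0 : 0 < c by rewrite normc_gt0.
have c40 : 0 < c / 4 by rewrite divr_gt0.
have [r [L [r0 rD rL]]] := Qlip zD.
have L0 : 0 < `|L| + 1 by rewrite ltr_wpDl.
(* The Lipschitz error and the error of the limit at [z] are each at most [c / 4], which leaves
   [sqinv] at least [c / 2] on the disc. *)
pose d := Num.min r (c / 4 / (`|L| + 1)).
have d0 : 0 < d by rewrite lt_min r0 divr_gt0.
have dr : d <= r by rewrite ge_min lexx.
exists d, (2 / c); split=> //.
  by apply: subset_trans rD => w; rewrite /cdisk /= => /lt_le_trans; apply.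
apply: filterS (Qq z c40) => i iz w wd.
have wL : normc (Q i w - Q i z) <= c / 4.
  apply: le_trans (rL i w z (lt_le_trans wd dr) (cdisk_center z r0)) _.
  apply: (@le_trans _ _ ((`|L| + 1) * normc (w - z))).
    by rewrite ler_wpM2r ?normc_ge0// (le_trans (ler_norm L))// lerDl.
  rewrite mulrC -ler_pdivlMr//; apply: le_trans (ltW wd) _.
  by rewrite ge_min lexx orbT.
have Qc : c / 2 <= sqinv (u i w).
  have : c <= normc (Q i w) + normc (Q i w - Q i z) + normc (Q i z - q z).
    rewrite /c {1}(_ : q z = Q i w - (Q i w - Q i z) - (Q i z - q z)); last by ring.
    apply: le_trans (le_normcD _ _) _; rewrite normcN lerD2r.
    by apply: le_trans (le_normcD _ _) _; rewrite normcN.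
  by rewrite normcQ; lra.
have c20 : 0 < c / 2 by rewrite divr_gt0.
have p0 : 0 < 1 + normc (u i w) ^+ 2 by rewrite ltr_pwDl// exprn_ge0// normc_ge0.
have : 1 + normc (u i w) ^+ 2 <= 2 / c.
  by rewrite -(invf_div c) -[leLHS]invrK lef_pV2// posrE ?invr_gt0.
apply: le_trans; have := sqr_ge0 (1 - normc (u i w)).
have := normc_ge0 (u i w); rewrite sqrrB expr1n mul1r -mulr_natl; lra.
Qed.

(** Near [z] the functions [u i] have modulus at least 1, so their inverses are holomorphic,
    zero-free and bounded by 1, and [ulim_hurwitz] applies. By [hQ] the limit of the inverses and
    [q] have the same zeros. *)
Lemma infinite_locally z : D z -> q z = 0 -> \forall w \near z, q w = 0.
Proof.
move=> zD qz.
have [r [L [r0 rD rL]]] := Qlip zD.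
have L0 : 0 < `|L| + 1 by rewrite ltr_wpDl.
pose d := Num.min r (1 / 4 / (`|L| + 1)).
have d0 : 0 < d by rewrite lt_min r0 divr_gt0.
have dr : d <= r by rewrite ge_min lexx.
have dD : cdisk z d `<=` D.
  by apply: subset_trans rD => w; rewrite /cdisk /= => /lt_le_trans; apply.
have Q2 : \forall i \near U, forall w, cdisk z d w -> sqinv (u i w) <= 1 / 2.
  have c40 : 0 < 1 / 4 :> R by rewrite divr_gt0.
  have := Qq z c40; rewrite qz; apply: filterS => i; rewrite subr0 => iz w wd.
  have wL : normc (Q i w - Q i z) <= 1 / 4.
    apply: le_trans (rL i w z (lt_le_trans wd dr) (cdisk_center z r0)) _.
    apply: (@le_trans _ _ ((`|L| + 1) * normc (w - z))).
      by rewrite ler_wpM2r ?normc_ge0// (le_trans (ler_norm L))// lerDl.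
    rewrite mulrC -ler_pdivlMr//; apply: le_trans (ltW wd) _.
    by rewrite ge_min lexx orbT.
  have : normc (Q i w) <= normc (Q i w - Q i z) + normc (Q i z).
    by rewrite -{1}[Q i w](subrK (Q i z)); exact: le_normcD.
  by rewrite [in X in X -> _]normcQ; lra.
have u1 : \forall i \near U, forall w, cdisk z d w -> 1 <= normc (u i w).
  apply: filterS Q2 => i iQ w /iQ.
  have p0 : 0 < 1 + normc (u i w) ^+ 2 by rewrite ltr_pwDl// exprn_ge0// normc_ge0.
  rewrite /sqinv -[X in _ <= X]invrK lef_pV2 ?posrE ?invr_gt0 ?divr_gt0//.
  rewrite invf_div divr1 => h; rewrite leNgt; apply/negP => n1.
  have := normc_ge0 (u i w); nra.
pose h i w := (u i w)^-1.
have hM : \forall i \near U, forall w, cdisk z d w -> normc (h i w) <= 1.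
  apply: filterS u1 => i i1 w /i1 w1; rewrite normcV invf_le1//.
  by rewrite (lt_le_trans ltr01).
have uN0 : \forall i \near U, forall w, cdisk z d w -> u i w != 0.
  by apply: filterS u1 => i i1 w /i1 w1; rewrite -normc_gt0 (lt_le_trans ltr01).
have [k kP] : exists k, forall w, cdisk z d w -> ulim U (h ^~ w) (k w).
  have H w : exists l, cdisk z d w -> ulim U (h ^~ w) l.
    have [wd|nwd] := pselect (cdisk z d w); last by exists 0.
    have [|l lP] := @ultra_bounded_ulim _ _ _ UU (h ^~ w) 1.
      by apply: filterS hM => i; apply.
    by exists l.
  by have [k kP] := choice H; exists k.
have hQ i w : u i w != 0 -> sqinv (u i w) <= 1 / 2 ->
    sqinv (u i w) <= normc (h i w) ^+ 2 <= 2 * sqinv (u i w).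
  move=> uw; rewrite normcV /sqinv; set N := normc (u i w).
  have N0 : 0 < N by rewrite normc_gt0.
  have N20 : 0 < N ^+ 2 by rewrite exprn_gt0.
  have p0 : 0 < 1 + N ^+ 2 by rewrite ltr_pwDl// ltW.
  rewrite exprVn -[1 / 2]invrK lef_pV2 ?posrE ?invr_gt0 ?divr_gt0//.
  rewrite invf_div divr1 => h2.
  rewrite lef_pV2 ?posrE// lerDr ler01/=.
  by rewrite -[leLHS]mul1r ler_pdivrMr// mulrAC ler_pdivlMr// mul1r; lra.
have kz : k z = 0.
  apply: (ulim_unique (kP z (cdisk_center z d0))) => e e0.
  have e2 : 0 < e ^+ 2 / 2 by rewrite divr_gt0// exprn_gt0.
  have := Qq z e2; rewrite qz => Qz.
  near=> i; rewrite subr0 -(@ler_pXn2r _ 2)// ?nnegrE ?normc_ge0 ?(ltW e0)//.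
  have iu : u i z != 0 by near: i; apply: filterS uN0 => j jP; exact/jP/cdisk_center.
  have i2 : sqinv (u i z) <= 1 / 2.
    by near: i; apply: filterS Q2 => j jP; exact/jP/cdisk_center.
  have iQ : normc (Q i z - 0) <= e ^+ 2 / 2 by near: i.
  have /andP[_ /le_trans] := hQ i z iu i2; apply.
  by move: iQ; rewrite subr0 normcQ; lra.
have k0 := @ulim_hurwitz _ _ _ UU h k z d 1 d0 _ hM _ kP kz.
have {}k0 : forall w, cdisk z (d / 16) w -> k w = 0.
  apply: k0.
  - by apply: filterS uN0 => i i0 w wd; apply: differentiableV; [exact/uh/dD | exact: i0].
  - by apply: filterS uN0 => i i0 w /i0; rewrite invr_eq0.
have sub : cdisk z (d / 16) `<=` cdisk z d.
  by move=> w; rewrite /cdisk /=; have := d0; lra.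
apply/nbhs_normcP; exists (d / 16); first by rewrite divr_gt0.
move=> w wd; have wd' := sub w wd.
apply: (ulim_unique (Qq w)) => e e0.
(* The bound 1 makes the square of [h i w] no larger than its modulus. *)
have c0 : 0 < Num.min 1 e by rewrite lt_min ltr01.
have := kP w wd' _ c0; rewrite k0// => kw.
near=> i; rewrite subr0 normcQ.
have iu : u i w != 0 by near: i; apply: filterS uN0 => j jP; exact: jP.
have i2 : sqinv (u i w) <= 1 / 2 by near: i; apply: filterS Q2 => j jP; exact: jP.
have /andP[/le_trans + _] := hQ i w iu i2; apply.
have : normc (h i w - 0) <= Num.min 1 e by near: i.
rewrite subr0 le_min => /andP[h1 he]; rewrite expr2.
by apply: le_trans he; rewrite -[leRHS]mul1r ler_wpM2r ?normc_ge0.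
Unshelve. all: by end_near. Qed.

Lemma limit_zero_or_nonzero :
  (forall z, D z -> q z != 0) \/ (forall z, D z -> q z = 0).
Proof.
have [[z0 z0D qz0]|nz] := pselect (exists2 z, D z & q z = 0); last first.
  by left=> z zD; apply/eqP => qz; apply: nz; exists z.
right=> z zD; pose p (t : R) := z0 + t%:C * (z - z0).
have pD t : 0 <= t <= 1 -> D (p t) := cdisk_line z0D zD.
have pnear (t : R) (P : set R[i]) : (\forall x \near p t, P x) ->
    \forall s \near t, P (p s).
  have c0 : 0 < normc (z - z0) + 1 by rewrite ltr_wpDl// normc_ge0.
  move=> /nbhs_normcP[d d0 dP]; apply/nbhs_ballP.
  exists (d / (normc (z - z0) + 1)); first by rewrite /= divr_gt0.
  move=> s; rewrite -ball_normE /= ltr_pdivlMr// distrC => sd; apply: dP.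
  rewrite (_ : _ - _ = (s - t)%:C * (z - z0)); last by rewrite /p rmorphB; ring.
  by rewrite normcM normc_real (le_lt_trans _ sd)// ler_wpM2l// lerDl.
have p0 : p 0 = z0 by rewrite /p rmorph0; ring.
have p1 : p 1 = z by rewrite /p rmorph1; ring.
pose B := [set t : R | 0 <= t <= 1 /\ q (p t) = 0].
(* [segment_connected] wants the zero set as the trace of an open and of a closed set of [R].
   Stating the conditions as implications leaves parameters outside the segment free, so the
   interiors in [R] have the right traces. *)
pose S1 := [set t : R | 0 <= t <= 1 -> q (p t) = 0].
pose S2 := [set t : R | 0 <= t <= 1 -> q (p t) != 0].
have AE (t : R) : `[0, 1]%classic t = (0 <= t <= 1) :> Prop by rewrite /= in_itv.
have B1 : B = `[0, 1] `&` S1^°.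
  apply/seteqP; split=> t.
    move=> [t01 qt]; split; first by rewrite AE.
    have := pnear t _ (infinite_locally (pD t t01) qt).
    by apply: filterS => s sq _.
  by rewrite /setI /= in_itv /= => -[t01 /interior_subset tS]; split=> //; exact: tS.
have B2 : B = `[0, 1] `&` ~` S2^°.
  apply/seteqP; split=> t.
    move=> [t01 qt]; split; first by rewrite AE.
    by move=> /interior_subset/(_ t01); rewrite qt eqxx.
  rewrite /setI /= in_itv /= => -[t01 tS]; split=> //.
  apply: contrapT => /eqP qt; apply: tS.
  have c0 : 0 < normc (q (p t)) / 2 by rewrite divr_gt0// normc_gt0.
  have := pnear t _ (qcont (pD t t01) c0); apply: filterS => s sq _.
  apply: contraTneq sq => ->; rewrite sub0r normcN -ltNge.
  by rewrite ltr_pdivrMr// ltr_pMr ?ltr1n// normc_gt0.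
have BA : B = `[0, 1]%classic.
  apply: (@segment_connected R 0 1).
  - by exists 0; split; [rewrite lexx ler01 | rewrite p0].
  - by exists S1^° => //; exact: open_interior.
  - by exists (~` S2^°) => //; apply: open_closedC; exact: open_interior.
have : B 1 by rewrite BA AE lexx ler01.
by case=> _; rewrite p1.
Qed.

Lemma finite_limit : (forall z, D z -> q z != 0) -> exists g : R[i] -> R[i],
  forall K : set R[i], compact K -> K `<=` D -> forall e : R, 0 < e ->
    \forall i \near U, forall z, K z -> normc (u i z - g z) <= e.
Proof.
move=> q0.
have [g gP] : exists g, forall z, D z -> ulim U (u ^~ z) (g z).
  have H z : exists l, D z -> ulim U (u ^~ z) l.
    have [zD|nzD] := pselect (D z); last by exists 0.
    have [r [M [r0 _ rM]]] := finite_locally_bounded zD (q0 z zD).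
    have [|l lP] := @ultra_bounded_ulim _ _ _ UU (u ^~ z) M.
      by apply: filterS rM => i; apply; exact: cdisk_center.
    by exists l.
  by have [g gP] := choice H; exists g.
exists g => K cK KD e e0; move/compact_near_coveringP: cK; apply => x /KD xD.
have [r [M [r0 rD rM]]] := finite_locally_bounded xD (q0 x xD).
have r20 : 0 < r / 2 by rewrite divr_gt0.
have rh i : holomorphic_on (cdisk x r) (u i) by move=> w /rD; exact: uh.
have sub : cdisk x (r / 2) `<=` D.
  by apply: subset_trans rD => w; rewrite /cdisk /=; have := r0; lra.
apply: (@ulim_locally_uniform _ _ _ UU u g x (r / 2) (16 * M / r)) => //.
  apply: filterS rM => i iM z w.
  exact: (holomorphic_lipschitz r0 (rh i) iM).
by move=> z /sub; exact: gP.
Qed.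

(** If [sqinv] is at most [(2 + M^2)^-1], the squared modulus is at least [1 + M^2], hence the
    strict inequality. *)
Lemma infinite_limit : (forall z, D z -> q z = 0) ->
  forall K : set R[i], compact K -> K `<=` D -> forall M : R,
    \forall i \near U, forall z, K z -> M < normc (u i z).
Proof.
move=> q0 K + KD M => /compact_near_coveringP/near_covering_withinP; apply.
move=> x /KD xD; have M0 : 0 < 2 + M ^+ 2 by rewrite ltr_wpDr// sqr_ge0.
have e0 : 0 < (2 + M ^+ 2)^-1 by rewrite invr_gt0.
apply: filterS (qunif xD e0) => -[z i] /= zi zK.
move: zi; rewrite q0; last exact: KD.
rewrite subr0 normcQ /sqinv => zi; set N := normc (u i z) in zi *.
have N0 : 0 <= N := normc_ge0 _.
have p0 : 0 < 1 + N ^+ 2 by rewrite ltr_pwDl// exprn_ge0.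
move: zi; rewrite lef_pV2// => zi; rewrite ltNge; apply/negP => NM.
by have := lerXn2r 2 (N0 : N \is Num.nneg) (le_trans N0 NM : M \is Num.nneg) NM; lra.
Qed.

End SphericalLimit.

Section Marty.
Variable R : realType.
Implicit Types (z w x : R[i]) (r e M : R).

(** Sets of [U] are nonempty even after cutting off an initial segment, so the conditions can be met
    one after another at increasing indices. *)
Lemma filter_subsequence (U : set_system nat) (FU : ProperFilter U)
    (A : nat -> set nat) : (forall N, \forall i \near U, (N <= i)%N) ->
  (forall j, \forall i \near U, A j i) ->
  exists s : nat -> nat, {homo s : m p / (m < p)%N} /\ forall j, A j (s j).
Proof.
move=> Uoo UA.
have H (jn : nat * nat) : exists m, (jn.2 < m)%N /\ A jn.1 m.
  by have [m []] := filter_ex (filterI (Uoo jn.2.+1) (UA jn.1)); exists m.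
have [F FP] := choice H.
pose s := fix s j := if j is j'.+1 then F (j, s j') else F (0%N, 0%N).
exists s; split; last first.
  by case=> [|j]; [have [] := FP (0%N, 0%N) | have [] := FP (j.+1, s j)].
by apply: homo_ltn => [|j]; [exact: ltn_trans | have [] := FP (j.+1, s j)].
Qed.

Lemma compact_exhaustion (K : set R[i]) : compact K -> K `<=` cdisk 0 1 ->
  \forall j \near \oo, K `<=` [set z | normc (z - 0) <= 1 - j.+1%:R^-1].
Proof.
move=> /compact_near_coveringP cK KD; apply: cK => x /KD; rewrite /cdisk /= => x1.
have e0 : 0 < (1 - normc (x - 0)) / 2 by rewrite divr_gt0// subr_gt0.
exists (cdisk x ((1 - normc (x - 0)) / 2),
    [set j | j.+1%:R^-1 < (1 - normc (x - 0)) / 2]).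
  split; first by apply/nbhs_normcP; exists ((1 - normc (x - 0)) / 2).
  exact: (near_infty_natSinv_lt (PosNum e0)).
move=> [w j] /= [wx jx].
have : normc (w - 0) <= normc (w - x) + normc (x - 0).
  by rewrite {1}(_ : w - 0 = (w - x) + (x - 0)); [exact: le_normcD | ring].
move: wx jx; rewrite /cdisk /= !subr0.
by move: (j.+1%:R^-1) => J wx jx h; lra.
Qed.

Lemma marty (u : nat -> R[i] -> R[i]) :
  (forall m, holomorphic_on (cdisk 0 1) (u m)) ->
  (forall z, cdisk 0 1 z -> exists r K, [/\ 0 < r, cdisk z r `<=` cdisk 0 1 &
    forall m w, cdisk z r w ->
      normc (derive1 (u m) w) <= K * (1 + normc (u m w) ^+ 2)]) ->
  exists s : nat -> nat, {homo s : m p / (m < p)%N} /\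
    ((exists g : R[i] -> R[i], forall K : set R[i], compact K -> K `<=` cdisk 0 1 ->
        forall e, 0 < e -> \forall m \near \oo,
          forall z, K z -> normc (u (s m) z - g z) <= e) \/
     (forall K : set R[i], compact K -> K `<=` cdisk 0 1 ->
        forall M, \forall m \near \oo, forall z, K z -> M < normc (u (s m) z))).
Proof.
move=> uh uK.
have [U [UU sU]] := ultraFilterLemma (@eventually_filter : ProperFilter \oo).
have Uoo N : \forall i \near U, (N <= i)%N by apply: sU; exists N.
have [q qP] : exists q, forall z, ulim U (fun m => (sqinv (u m z))%:C) (q z).
  have H z : exists l, ulim U (fun m => (sqinv (u m z))%:C) l.
    apply: (@ultra_bounded_ulim _ _ _ UU _ 1); apply: filterE => i.
    by rewrite normc_real gtr0_norm ?sqinv_gt0// sqinv_le1.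
  by have [q qP] := choice H; exists q.
pose KK j : set R[i] := [set z | normc (z - 0) <= 1 - j.+1%:R^-1].
have KKc j : compact (KK j) by exact: closed_cdisk_compact.
have KKD j : KK j `<=` cdisk 0 1.
  by move=> z; rewrite /KK /cdisk /= => /le_lt_trans; apply; rewrite ltrBlDr ltrDl invr_gt0.
have [q0|q0] := limit_zero_or_nonzero uh uK qP.
  have [g gP] := finite_limit uh uK qP q0.
  have j0 j : 0 < j.+1%:R^-1 :> R by rewrite invr_gt0.
  (* The [j]-th condition asks for error at most [1 / (j + 1)] on the [j]-th exhausting disc; every
     compact set lies in almost all of these discs. *)
  have [s [s1 sP]] := filter_subsequence _ Uoo
    (fun j => gP (KK j) (KKc j) (KKD j) _ (j0 j)).
  exists s; split=> //; left; exists g => K cK KD e e0; near=> j => z zK.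
  apply: le_trans (sP j z _) _.
    by move: z zK; near: j; exact: compact_exhaustion.
  by apply: ltW; near: j; exact: (near_infty_natSinv_lt (PosNum e0)).
have [s [s1 sP]] := filter_subsequence _ Uoo
  (fun j => infinite_limit uh uK qP q0 (KKc j) (KKD j) j%:R).
exists s; split=> //; right => K cK KD M; near=> j => z zK.
apply: le_lt_trans (sP j z _); first by near: j; exact: nbhs_infty_ger.
by move: z zK; near: j; exact: compact_exhaustion.
Unshelve. all: by end_near. Qed.

End Marty.

(** * The Levi form of log (1 + |f|^2) *)

Section RealCurves.
Variable R : realType.
Implicit Types (p q : R -> R[i]) (t : R) (k l : R[i]).

(** The componentwise derivative of [real_derive]; conjugates and moduli of holomorphic functions
    are differentiable only in this real sense. *)
Definition is_cderive p t l :=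
  is_derive t 1 (fun s => complex.Re (p s)) (complex.Re l) /\
  is_derive t 1 (fun s => complex.Im (p s)) (complex.Im l).

Lemma is_cderiveM p q t k l : is_cderive p t k -> is_cderive q t l ->
  is_cderive (fun s => p s * q s) t (k * q t + p t * l).
Proof.
move=> [p1 p2] [q1 q2]; split.
  under eq_fun do rewrite reM.
  apply: is_derive_eq (is_deriveB (is_deriveM p1 q1) (is_deriveM p2 q2)) _.
  by rewrite reD !reM /GRing.scale /=; ring.
under eq_fun do rewrite imM.
apply: is_derive_eq (is_deriveD (is_deriveM p1 q2) (is_deriveM p2 q1)) _.
by rewrite imD !imM /GRing.scale /=; ring.
Qed.

Lemma is_cderive_conj p t l : is_cderive p t l ->
  is_cderive (fun s => (p s)^*%C) t l^*%C.
Proof.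
have reJ (z : R[i]) : complex.Re z^*%C = complex.Re z by case: z.
have imJ (z : R[i]) : complex.Im z^*%C = - complex.Im z by case: z.
move=> [p1 p2]; split; first by under eq_fun do rewrite reJ; rewrite reJ.
by under eq_fun do rewrite imJ; rewrite imJ; exact: is_deriveN.
Qed.

Lemma is_cderive_real (x : R -> R) t (l : R) : is_derive t 1 x l ->
  is_cderive (fun s => (x s)%:C) t l%:C.
Proof. by move=> xl; split=> //=; exact: is_derive_cst. Qed.

Lemma is_derive_sqr_normc p t l : is_cderive p t l ->
  is_derive t 1 (fun s => 1 + normc (p s) ^+ 2)
    (2 * complex.Re ((p t)^*%C * l)).
Proof.
move=> [p1 p2]; under eq_fun do rewrite sqr_normcE.
have := is_deriveD (is_derive_cst (1 : R) t 1)
  (is_deriveD (is_deriveX 2 p1) (is_deriveX 2 p2)).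
move/is_derive_eq; apply; rewrite /GRing.scale /= !expr1.
by move: {p1 p2} l (p t) => [a b] [c d] /=; ring.
Qed.

End RealCurves.

Lemma derive1_chain (R : realType) (V W : normedModType R[i]) (f : V -> W)
    (g : R[i] -> V) (c : R[i]) :
  differentiable g c -> differentiable f (g c) ->
  derive1 (f \o g) c = 'd f (g c) (derive1 g c).
Proof.
move=> gd fd.
have fgd : differentiable (f \o g) c := differentiable_comp gd fd.
have E1 := derive1E' fgd; have E2 := derive1E' gd.
have E3 := congr1 (fun h : R[i] -> W => h 1) (diff_comp gd fd).
by rewrite E1 E2; exact: E3.
Qed.

Section SeveralVariables.
Variables (R : realType) (n : nat).
Implicit Types (z v w : 'rV[R[i]]_n) (f : 'rV[R[i]]_n -> R[i]).

Lemma diff_along_curve f (g : R[i] -> 'rV[R[i]]_n) (c : R[i]) :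
  differentiable g c -> differentiable f (g c) ->
  is_derive c 1 (f \o g) ('d f (g c) (derive1 g c)).
Proof.
move=> gd fd; rewrite -(derive1_chain gd fd).
exact: differentiable_is_derive (differentiable_comp gd fd).
Qed.

Lemma is_derive_affine z v (c : R[i]) :
  is_derive c 1 (fun s : R[i] => z + s *: v) v.
Proof.
have H : is_derive c 1 (fun s : R[i] => s *: v) v.
  have d1 : differentiable (fun s : R[i] => s *: v) c.
    by apply: differentiableZl.
  split; first exact/derivable1_diffP.
  by rewrite deriveE// diffZl// diff_val scale1r.
have := is_deriveD (is_derive_cst z c 1) H.
by move/is_derive_eq; apply; rewrite add0r.
Qed.

Lemma differentiable_affine z v (c : R[i]) :
  differentiable (fun s : R[i] => z + s *: v) c.
Proof. exact/derivable1_diffP/ex_derive/is_derive_affine. Qed.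

Lemma is_derive_along_line f z v (c : R[i]) : differentiable f (z + c *: v) ->
  is_derive c 1 (fun s => f (z + s *: v)) ('d f (z + c *: v) v).
Proof.
move=> fd; have := diff_along_curve (differentiable_affine z v c) fd.
by rewrite (_ : derive1 _ c = v) // derive1E; have [_ ->] := is_derive_affine z v c.
Qed.

(** The two parameters supply the bidisc needed for mixed second derivatives; with one vector equal
    to 0 it handles a single line. *)
Lemma line2_near z v w (P : set 'rV[R[i]]_n) : (\forall x \near z, P x) ->
  exists2 d : R, 0 < d & forall s t, normc s < d -> normc t < d ->
    P (z + s *: v + t *: w).
Proof.
move=> /nbhs_ballP[e /= e0 eP].
have eE : e = (complex.Re e)%:C by rewrite RRe_real// gtr0_real.
have nE (x : 'rV[R[i]]_n) : exists2 a : R, 0 <= a & `|x| = a%:C.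
  exists (complex.Re `|x|); last by rewrite RRe_real// normr_real.
  by rewrite -lecR RRe_real ?normr_real ?normr_ge0.
have [a a0 aE] := nE v; have [b b0 bE] := nE w.
have c0 : 0 < a + b + 1 by rewrite ltr_wpDl// addr_ge0.
exists (complex.Re e / (a + b + 1)); first by rewrite divr_gt0// -ltcR -eE.
move=> s t; rewrite !ltr_pdivlMr// => se te; apply: eP.
rewrite -ball_normE /= -addrA opprD addrA subrr sub0r normrN.
apply: le_lt_trans (ler_normD _ _) _; rewrite !normrZ aE bE !normr_normc eE.
rewrite -!(rmorphM (real_complex R)) -(rmorphD (real_complex R)) ltcR.
have [st|ts] := leP (normc s) (normc t).
  apply: le_lt_trans te; rewrite !mulrDr mulr1.
  have := ler_wpM2r a0 st; have := normc_ge0 t; lra.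
apply: le_lt_trans se; rewrite !mulrDr mulr1.
have := ler_wpM2r b0 (ltW ts); have := normc_ge0 s; lra.
Qed.

End SeveralVariables.

Section LeviForm.
Variables (R : realType) (n : nat) (Omega : set 'rV[R[i]]_n).
Variable f : 'rV[R[i]]_n -> R[i].
Hypotheses (Omega_open : open Omega) (fh : holomorphic_on Omega f).
Implicit Types (p z v w : 'rV[R[i]]_n) (k l : 'I_n).

Let e k : 'rV[R[i]]_n := delta_mx 0 k.
Let D k p : R[i] := 'd f p (e k).
Let S p : R := 1 + normc (f p) ^+ 2.

Let S_gt0 p : 0 < S p.
Proof. by rewrite ltr_pwDl// exprn_ge0// normc_ge0. Qed.

(** The values [c = 1] and [c = 'i] are the two real directions in the Wirtinger derivatives. *)
Lemma is_cderive_curve (g : 'rV[R[i]]_n -> R[i]) p v (c a : R[i]) :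
  is_derive (0 : R[i]) 1 (fun s => g (p + s *: v)) a ->
  is_cderive (fun t => g (p + t%:C *: (c *: v))) 0 (a * c).
Proof.
move=> ga; have := @is_derive_line R (fun s => g (p + s *: v)) 0 c a 0.
rewrite rmorph0 mul0r addr0 => /(_ ga)[h1 h2].
have E t : g (p + t%:C *: (c *: v)) = g (p + (0 + t%:C * c) *: v).
  by rewrite add0r scalerA.
by split; under eq_fun do rewrite E.
Qed.

Lemma real_derive_val (g : 'rV[R[i]]_n -> R[i]) w z (a : R[i]) :
  is_cderive (fun t => g (z + t%:C *: w)) 0 a -> real_derive w g z = a.
Proof.
move=> [[_ g1] [_ g2]]; rewrite /real_derive !derive1E g1 g2.
by case: a {g1 g2}.
Qed.

Let fD p k : Omega p -> is_derive (0 : R[i]) 1 (fun s => f (p + s *: e k)) (D k p).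
Proof.
move=> Op; have := @is_derive_along_line R n f p (e k) 0.
by rewrite scale0r addr0; apply; exact: fh.
Qed.

Let wirtinger_barE k (g : 'rV[R[i]]_n -> R[i]) z (a b : R[i]) :
  is_cderive (fun t => g (z + t%:C *: (1 *: e k))) 0 a ->
  is_cderive (fun t => g (z + t%:C *: ('i%C *: e k))) 0 b ->
  wirtinger_bar k g z = (a + 'i%C * b) / 2.
Proof.
by move=> /real_derive_val ga /real_derive_val gb; rewrite /wirtinger_bar -ga -gb scale1r.
Qed.

Let wirtingerE k (g : 'rV[R[i]]_n -> R[i]) z (a b : R[i]) :
  is_cderive (fun t => g (z + t%:C *: (1 *: e k))) 0 a ->
  is_cderive (fun t => g (z + t%:C *: ('i%C *: e k))) 0 b ->
  wirtinger k g z = (a - 'i%C * b) / 2.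
Proof.
by move=> /real_derive_val ga /real_derive_val gb; rewrite /wirtinger -ga -gb scale1r.
Qed.

(** In direction [c *: e k] the derivative of [ln S] is [2 Re (f^* D c) / S]; combining [c = 1] and
    [c = 'i] keeps the part that is linear in the conjugate of [c]. *)
Lemma wirtinger_bar_log k p : Omega p ->
  wirtinger_bar k (fun w => (ln (S w))%:C) p =
    f p * (D k p)^*%C * ((S p)^-1)%:C.
Proof.
move=> Op.
have H c : is_cderive (fun t => (ln (S (p + t%:C *: (c *: e k))))%:C) 0
    ((S p)^-1 * (2 * complex.Re ((f p)^*%C * (D k p * c))))%:C.
  apply: is_cderive_real.
  have := is_derive_sqr_normc (is_cderive_curve c (fD k Op)).
  rewrite rmorph0 scale0r addr0 => HS.
  have L : is_derive (1 + normc (f (p + (0 : R)%:C *: (c *: e k))) ^+ 2) 1 (@ln R) (S p)^-1.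
    by rewrite rmorph0 scale0r addr0; apply: is_derive1_ln; exact: S_gt0.
  exact: (@is_derive1_comp _ (@ln R)
    (fun t => 1 + normc (f (p + t%:C *: (c *: e k))) ^+ 2) 0 _ _ L HS).
rewrite (wirtinger_barE (H 1) (H 'i%C)) mulr1.
move: (S p)^-1 (f p) (D k p) => s [a b] [c d].
by apply/eqP; rewrite eq_complex /=; apply/andP; split; apply/eqP; field.
Qed.

(** Only existence is asked: the value [b] enters the next computation through the conjugate of
    [b * c] and is removed by the Wirtinger derivative. *)
Lemma is_derive_partial k l z : Omega z ->
  exists b, is_derive (0 : R[i]) 1 (fun s => D l (z + s *: e k)) b.
Proof.
move=> Oz.
have nearz : \forall x \near z, Omega x /\ normc (f x) <= normc (f z) + 1.
  apply: filterI; first exact: open_nbhs_nbhs.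
  have /differentiable_continuous := fh Oz.
  move=> /(@cvgrPdist_le _ _ _ (nbhs z) _)/(_ 1 ltr01); apply: filterS => x.
  rewrite normr_normc -[1]/(1%:C) lecR normcB => fx.
  by rewrite -[f x](subrK (f z)) addrC (le_trans (le_normcD _ _))// lerD2l.
have [d d0 dP] := line2_near (e k) (e l) nearz.
pose Phi (s t : R[i]) := f (z + s *: e k + t *: e l).
have Phid : differentiable (fun s => derive1 (Phi s) 0) 0.
  apply: (@differentiable_partial _ Phi d (normc (f z) + 1) d0) => s t.
  rewrite /cdisk /= !subr0 => sd td; have [Os Ms] := dP s t sd td.
  split; last exact: Ms.
  - have E : Phi^~ t = (fun s => f (z + t *: e l + s *: e k)).
      by apply/funext => r; rewrite /Phi addrAC.
    have Os' : Omega (z + t *: e l + s *: e k) by rewrite addrAC.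
    rewrite E; exact: is_derive_differentiable (is_derive_along_line (fh Os')).
  - exact: is_derive_differentiable (is_derive_along_line (fh Os)).
exists (derive1 (fun s => derive1 (Phi s) 0) 0).
apply: near_eq_is_derive (differentiable_is_derive Phid).
apply/nbhs_normcP; exists d; first exact: d0.
move=> s; rewrite subr0 => sd.
have [] := dP s 0 sd; first by rewrite normc0.
rewrite scale0r addr0 => Os _; apply: is_derive_derive1.
have := @is_derive_along_line R n f (z + s *: e k) (e l) 0.
by rewrite scale0r addr0; apply; exact: fh.
Qed.

Lemma wirtinger_wirtinger_bar_log k l z : Omega z ->
  wirtinger k (wirtinger_bar l (fun w => (ln (S w))%:C)) z =
    D k z * (D l z)^*%C * ((S z)^-1 ^+ 2)%:C.
Proof.
move=> Oz; have [b Db] := is_derive_partial k l Oz.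
pose N p := f p * (D l p)^*%C * ((S p)^-1)%:C.
pose F := f z; pose A := D k z; pose B := D l z; pose s := (S z)^-1.
(* The derivative of [N] in the direction [c *: e k]; its part that is linear in
   the conjugate of [c] disappears from [(val 1 - 'i * val 'i) / 2]. *)
pose val c := ((A * c) * B^*%C + F * (b * c)^*%C) * s%:C
   - F * B^*%C * (s ^+ 2 * (2 * complex.Re (F^*%C * (A * c))))%:C.
have HN c : is_cderive (fun t => N (z + t%:C *: (c *: e k))) 0 (val c).
  have h1 := is_cderive_curve c (fD k Oz).
  have h2 := is_cderive_conj (is_cderive_curve c Db).
  have h3 := is_derive_sqr_normc h1.
  have z0 : z + (0 : R)%:C *: (c *: e k) = z by rewrite rmorph0 scale0r addr0.
  have S0 : 1 + normc (f (z + (0 : R)%:C *: (c *: e k))) ^+ 2 != 0.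
    by rewrite z0 gt_eqF// S_gt0.
  have h4 := @is_deriveV R (fun t => 1 + normc (f (z + t%:C *: (c *: e k))) ^+ 2)
    0 _ _ S0 h3.
  have := is_cderiveM (is_cderiveM h1 h2) (is_cderive_real h4).
  rewrite z0; congr (is_cderive _ _ _).
  rewrite /val /s /GRing.scale /= -exprVn mulNr rmorphN mulrN.
  by [].
(* The formula for [wirtinger_bar] is available on [Omega] only, which contains the line near [z]
   because it is open. *)
have nearO c : \forall t \near (0 : R),
    N (z + t%:C *: (c *: e k)) =
    wirtinger_bar l (fun w => (ln (S w))%:C) (z + t%:C *: (c *: e k)).
  have [d d0 dP] := line2_near (c *: e k) 0 (open_nbhs_nbhs (conj Omega_open Oz)).
  apply/nbhs_ballP; exists d => // t; rewrite -ball_normE /= sub0r normrN => td.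
  rewrite wirtinger_bar_log//; have := dP t%:C 0.
  by rewrite normc_real normc0 scaler0 addr0; apply.
have Hw c : is_cderive (fun t => wirtinger_bar l (fun w => (ln (S w))%:C)
    (z + t%:C *: (c *: e k))) 0 (val c).
  have [N1 N2] := HN c; split.
    apply: near_eq_is_derive N1; apply: filterS (nearO c) => t.
    by move=> ->.
  by apply: near_eq_is_derive N2; apply: filterS (nearO c) => t ->.
rewrite (wirtingerE (Hw 1) (Hw 'i%C)).
(* This merges the two terms of the product rule: [s - s^2 |F|^2 = s^2]. *)
have sF : s = s ^+ 2 * (1 + complex.Re F ^+ 2 + complex.Im F ^+ 2).
  by rewrite -addrA -sqr_normcE expr2 -mulrA mulVf ?mulr1// gt_eqF// S_gt0.
rewrite -/A -/B -/s.
have -> : (val 1 - 'i%C * val 'i%C) / 2 =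
    A * B^*%C * s%:C - F * F^*%C * A * B^*%C * (s ^+ 2)%:C.
  rewrite /val; move: (s) (A) (B) (F) (b) => r [a1 a2] [b1 b2] [f1 f2] [c1 c2].
  by apply/eqP; rewrite eq_complex /=; apply/andP; split; apply/eqP; field.
rewrite {1}sF; move: (s) (A) (B) (F) => r [a1 a2] [b1 b2] [f1 f2].
by apply/eqP; rewrite eq_complex /=; apply/andP; split; apply/eqP; ring.
Qed.

(** The coefficients have rank one, so the double sum factors as the differential at [v] times its
    conjugate. *)
Lemma levi_form_log z v : Omega z ->
  levi_form (fun w => ln (1 + normc (f w) ^+ 2)) z v =
    ((normc ('d f z v) / (1 + normc (f z) ^+ 2)) ^+ 2)%:C.
Proof.
move=> Oz; have Ev : 'd f z v = \sum_(k < n) v 0 k * D k z.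
  rewrite {1}[v]row_sum_delta linear_sum; apply: eq_bigr => k _.
  by rewrite linearZ.
have -> : ((normc ('d f z v) / (1 + normc (f z) ^+ 2)) ^+ 2)%:C =
    'd f z v * ('d f z v)^*%C * ((S z)^-1 ^+ 2)%:C.
  rewrite exprMn (sqr_normcE ('d f z v)) -/(S z); move: (S z)^-1 ('d f z v) => s [c d].
  apply/eqP; rewrite eq_complex /=; apply/andP; split; apply/eqP; ring.
rewrite Ev rmorph_sum /= /levi_form big_distrlr /= mulr_suml; apply: eq_bigr => k _.
rewrite mulr_suml; apply: eq_bigr => l _.
by rewrite wirtinger_wirtinger_bar_log// rmorphM /=; ring.
Qed.

End LeviForm.

(** * The Kobayashi metric *)

Section Kobayashi.
Variables (R : realType) (n : nat) (Omega : set 'rV[R[i]]_n).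
Implicit Types (z v : 'rV[R[i]]_n) (phi : R[i] -> 'rV[R[i]]_n).

Lemma unit_diskE : unit_disk R = cdisk 0 1.
Proof.
have E (z : R[i]) : (`|z| < 1) = (normc z < 1) := ltcR (normc z) 1.
by apply/seteqP; split=> z; rewrite /unit_disk /cdisk /= subr0 E.
Qed.

Let discs z v := [set alpha : R | 0 < alpha /\
    exists phi : R[i] -> 'rV[R[i]]_n,
      [/\ holomorphic_disk Omega phi, phi 0 = z
        & derive1 phi 0 = (alpha^-1)%:C *: v]].

Let discs_lb z v : lbound (discs z v) 0.
Proof. by move=> a [/ltW]. Qed.

(** Composing [phi] with [s |-> c + (1 - |c|) s], which maps the disk into itself, gives a
    competitor in the infimum with [alpha = (1 - |c|)^-1]. *)
Lemma kobayashi_metric_le (phi : R[i] -> 'rV[R[i]]_n) (c : R[i]) :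
  holomorphic_disk Omega phi -> unit_disk R c ->
  0 <= kobayashi_metric Omega (phi c) (derive1 phi c) <= (1 - normc c)^-1.
Proof.
move=> [phid phiO]; rewrite unit_diskE => cD.
have r0 : 0 < 1 - normc c by move: cD; rewrite /cdisk /= subr0 subr_gt0.
have H : discs (phi c) (derive1 phi c) (1 - normc c)^-1.
  split; first by rewrite invr_gt0.
  pose g (s : R[i]) := c + s *: (1 - normc c)%:C.
  have gD s : unit_disk R s -> unit_disk R (g s).
    rewrite unit_diskE /cdisk /= !subr0 => s1.
    apply: le_lt_trans (le_normcD _ _) _; rewrite normcM normc_real gtr0_norm//.
    by rewrite -ltrBrDl -[ltRHS]mul1r ltr_pM2r.
  have gd s : differentiable g s.
    apply: differentiableD; first exact: differentiable_cst.
    exact: differentiableZl.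
  exists (phi \o g); split.
  - split=> s sD; last exact/phiO/gD.
    by apply: differentiable_comp; [exact: gd | exact/phid/gD].
  - by rewrite /= /g scale0r addr0.
  - have g0 : g 0 = c by rewrite /g scale0r addr0.
    have phid' : differentiable phi c by apply: phid; rewrite unit_diskE.
    have phic : differentiable phi (g 0) by rewrite g0.
    have dg : is_derive (0 : R[i]) 1 g (1 - normc c)%:C.
      apply/is_derive_normcP => e e0.
      exists 1; first exact: ltr01.
      move=> s _.
      rewrite [X in normc X](_ : _ = 0); last by rewrite /g /GRing.scale /=; ring.
      by rewrite normc0 mulr_ge0 ?normc_ge0// ltW.
    rewrite (derive1_chain (gd 0) phic) (is_derive_derive1 dg) g0.
    rewrite invrK (derive1E' phid') -linearZ.
    by congr ('d phi c _); rewrite [RHS]mulr1.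
apply/andP; split.
  by apply: lb_le_inf; [exists (1 - normc c)^-1 | exact: discs_lb].
by apply: ge_inf; [exists 0; exact: discs_lb | exact: H].
Qed.

Lemma kobayashi_disc z v (r : R) : open Omega -> Omega z ->
  kobayashi_metric Omega z v < r ->
  exists alpha phi, [/\ 0 < alpha < r, holomorphic_disk Omega phi, phi 0 = z
    & derive1 phi 0 = (alpha^-1)%:C *: v].
Proof.
move=> oO Oz kr.
have [d d0 dP] := line2_near v 0 (open_nbhs_nbhs (conj oO Oz)).
(* The infimum is meaningful only for a nonempty set; a small affine disc in the open set [Omega] is
   a competitor. *)
have ne : discs z v !=set0.
  exists (2 / d); split; first by rewrite divr_gt0.
  exists (fun s : R[i] => z + s *: ((d / 2)%:C *: v)).
  have dv s := differentiable_affine z ((d / 2)%:C *: v) s.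
  split.
  - split=> s; first by move=> _; exact: dv.
    rewrite unit_diskE /cdisk /= subr0 => s1; rewrite scalerA.
    have := dP (s * (d / 2)%:C) 0; rewrite scaler0 addr0; apply.
      rewrite normcM normc_real gtr0_norm ?divr_gt0//.
      have := ler_pM (normc_ge0 s) (ltW (divr_gt0 d0 (ltr0n R 2))) (ltW s1) (lexx _).
      by move: d0; lra.
    by rewrite normc0.
  - by rewrite scale0r addr0.
  - by rewrite derive1E invf_div; have [_ ->] := is_derive_affine z ((d / 2)%:C *: v) 0.
have [a [a0 [phi [phid phi0 phi1]]] ar] := inf_lt ne kr.
by exists a, phi; rewrite a0 ar.
Qed.

End Kobayashi.

Lemma uniform_normcP (R : realType) (K : set R[i]) (u : nat -> R[i] -> R[i])
    (g : R[i] -> R[i]) :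
  {uniform K, u @ \oo --> g} <-> forall e : R, 0 < e -> \forall m \near \oo,
    forall z, K z -> normc (u m z - g z) <= e.
Proof.
split.
  move=> ug e e0; have ec0 : 0 < e%:C :> R[i] by rewrite ltcR.
  have /ug : nbhs (g : {uniform` K -> R[i]})
      [set h | forall z, K z -> normc (h z - g z) <= e].
    apply/uniform_nbhs; exists [set xy | ball xy.1 e%:C xy.2]; split.
      by rewrite -entourage_ballE; exists e%:C.
    move=> h /= hg z /hg; rewrite -ball_normE /= normr_normc ltcR normcB.
    exact: ltW.
  by [].
move=> H P /uniform_nbhs[E [entE EP]].
move: entE; rewrite -entourage_ballE => -[e /= e0 eE].
have eC : e = (complex.Re e)%:C by rewrite RRe_real// gtr0_real.
have e20 : 0 < complex.Re e / 2 by rewrite divr_gt0// -ltcR -eC.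
apply: filterS (H _ e20) => m mP; apply: EP => z /mP zm; apply: eE => /=.
rewrite -ball_normE /= normr_normc eC ltcR normcB (le_lt_trans zm)//.
by move: e20; lra.
Qed.

(** * The two implications between normal functions and normal families *)

Section Directions.
Variables (R : realType) (n : nat) (Omega : set 'rV[R[i]]_n).
Variable f : 'rV[R[i]]_n -> R[i].
Hypotheses (Omega_open : open Omega) (fh : holomorphic_on Omega f).

Let discs : set (R[i] -> R[i]) := [set g | exists phi : R[i] -> 'rV[R[i]]_n,
  holomorphic_disk Omega phi /\ g = f \o phi].

Lemma holomorphic_disk_comp (phi : R[i] -> 'rV[R[i]]_n) :
  holomorphic_disk Omega phi -> holomorphic_on (cdisk 0 1) (f \o phi).
Proof.
move=> [phid phiO] z; rewrite -unit_diskE => zD.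
exact: differentiable_comp (phid z zD) (fh (phiO z zD)).
Qed.

(** The constant [C + 1] stands for the square root of [C], as [C <= (C + 1)^2]. *)
Lemma spherical_derivative_bound (C : R) (phi : R[i] -> 'rV[R[i]]_n) w : 0 < C ->
  (forall z v : 'rV[R[i]]_n, Omega z ->
     levi_form (fun x => ln (1 + normc (f x) ^+ 2)) z v
       <= (C * kobayashi_metric Omega z v ^+ 2)%:C) ->
  holomorphic_disk Omega phi -> cdisk 0 1 w ->
  normc (derive1 (f \o phi) w) <=
    (C + 1) * (1 - normc w)^-1 * (1 + normc (f (phi w)) ^+ 2).
Proof.
move=> C0 fC phiD wD; have [phid phiO] := phiD.
rewrite -unit_diskE in wD.
have := fC (phi w) (derive1 phi w) (phiO w wD).
rewrite (levi_form_log Omega_open fh)//; last exact: phiO.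
rewrite lecR -(derive1_chain (phid w wD) (fh (phiO w wD))).
have /andP[k0 k1] := kobayashi_metric_le phiD wD.
set k := kobayashi_metric _ _ _ in k0 k1 *.
set N := normc _; set T := 1 + _ => H.
have T0 : 0 < T by rewrite ltr_pwDl// exprn_ge0// normc_ge0.
have C1 : 0 < C + 1 by rewrite addr_gt0.
have w0 : 0 <= (1 - normc w)^-1 := le_trans k0 k1.
rewrite -ler_pdivrMr// -(@ler_pXn2r _ 2)// ?nnegrE; last 2 first.
- by rewrite divr_ge0 ?normc_ge0// ltW.
- by rewrite mulr_ge0// ltW.
apply: le_trans H _; rewrite exprMn; apply: ler_pM.
- exact: ltW.
- exact: exprn_ge0.
- by rewrite expr2; nra.
- by apply: lerXn2r; rewrite ?nnegrE.
Qed.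

Lemma normal_function_normal_family :
  normal_function Omega f -> normal_family_on_disk discs.
Proof.
move=> [_ [C [C0 fC]]]; split.
  by move=> g [phi [phiD ->]]; rewrite unit_diskE; exact: holomorphic_disk_comp.
move=> u uF; have [phi phiP] := choice uF.
have uh m : holomorphic_on (cdisk 0 1) (u m).
  by have [phiD ->] := phiP m; exact: holomorphic_disk_comp.
have uK z : cdisk 0 1 z -> exists r K, [/\ 0 < r, cdisk z r `<=` cdisk 0 1 &
    forall m w, cdisk z r w ->
      normc (derive1 (u m) w) <= K * (1 + normc (u m w) ^+ 2)].
  (* Half the distance to the unit circle, so that [1 - |w|] is at least [r] on the whole disc of
     radius [r] around [z]. *)
  move=> zD; pose r := (1 - normc z) / 2.
  have r0 : 0 < r.
    by rewrite divr_gt0// subr_gt0; move: zD; rewrite /cdisk /= subr0.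
  have sub w : cdisk z r w -> normc w < 1 - r.
    rewrite /cdisk /= => wz; have : normc w <= normc (w - z) + normc z.
      by rewrite -{1}[w](subrK z); exact: le_normcD.
    by move: wz r0; rewrite /r; lra.
  have subD : cdisk z r `<=` cdisk 0 1.
    by move=> w /sub; rewrite /cdisk /= subr0; move: r0; lra.
  exists r, ((C + 1) * r^-1); split=> // m w wr.
  have [phiD ->] := phiP m.
  apply: le_trans (spherical_derivative_bound C0 fC phiD (subD w wr)) _.
  apply: ler_wpM2r; first by rewrite addr_ge0// exprn_ge0// normc_ge0.
  apply: ler_wpM2l; first by rewrite addr_ge0// ltW.
  have wr1 := sub w wr; have r1 : r <= 1 - normc w by lra.
  by rewrite lef_pV2// posrE (lt_le_trans r0).
have [s [s1 sP]] := marty uh uK; exists s; split=> //.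
rewrite unit_diskE; case: sP => [[g gP]|iP]; [left | right].
  exists g => K cK KD; apply/uniform_normcP => e e0; exact: gP.
move=> K cK KD M; apply: filterS (iP K cK KD M) => m mM z zK.
by rewrite normr_normc ltcR; exact: mM.
Qed.

(** Failure at [z], [v] means that the metric is less than [N / (T * C)], so some disc has [alpha]
    below this value too; along it the derivative at 0 has modulus [N / alpha > C * T]. *)
Lemma not_normal_disc (C : R) : 0 < C ->
  ~ (forall z v : 'rV[R[i]]_n, Omega z ->
     levi_form (fun x => ln (1 + normc (f x) ^+ 2)) z v
       <= (C ^+ 2 * kobayashi_metric Omega z v ^+ 2)%:C) ->
  exists g, discs g /\ C * (1 + normc (g 0) ^+ 2) < normc (derive1 g 0).
Proof.
move=> C0 /existsNP[z /existsNP[v /not_implyP[Oz /negP]]].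
rewrite (levi_form_log Omega_open fh)// lecR -ltNge -exprMn.
set T := 1 + _; set N := normc _.
have T0 : 0 < T by rewrite ltr_pwDl// exprn_ge0// normc_ge0.
have NT0 : 0 <= N / T by rewrite divr_ge0 ?normc_ge0// ltW.
move=> H.
have k1 : kobayashi_metric Omega z v < N / T / C.
  rewrite ltr_pdivlMr// mulrC ltNge; apply/negP => kC.
  by move: H; rewrite ltNge => /negP; apply; apply: lerXn2r; rewrite ?nnegrE// (le_trans NT0).
have [a [phi [/andP[a0 aN] phiD phi0 phi1]]] := kobayashi_disc Omega_open Oz k1.
exists (f \o phi); split; first by exists phi.
have D0 : unit_disk R 0 by rewrite unit_diskE; exact: cdisk_center.
have [phid phiO] := phiD.
rewrite (derive1_chain (phid 0 D0) (fh (phiO 0 D0))) phi1 /comp phi0 linearZ.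
rewrite normcM normc_real gtr0_norm ?invr_gt0// -/T -/N.
rewrite [ltRHS]mulrC ltr_pdivlMr// (mulrC _ a) mulrA.
by move: aN; rewrite !ltr_pdivlMr.
Qed.

Lemma normal_family_normal_function :
  normal_family_on_disk discs -> normal_function Omega f.
Proof.
move=> [_ dn]; split=> //; apply: contrapT => nC.
have H (m : nat) : exists g,
    discs g /\ m.+1%:R * (1 + normc (g 0) ^+ 2) < normc (derive1 g 0).
  apply: not_normal_disc => // fC; apply: nC; exists (m.+1%:R ^+ 2); split=> //.
have [u uP] := choice H.
have [s [s1 sP]] := dn u (fun m => (uP m).1).
have sm m : (m <= s m)%N.
  elim: m => // m IH; apply: leq_ltn_trans IH _; exact: s1.
have uh m : holomorphic_on (cdisk 0 1) (u m).
  by have [[phi [phiD ->]] _] := uP m; exact: holomorphic_disk_comp.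
have subD : cdisk (0 : R[i]) (1 / 2) `<=` cdisk 0 1.
  by move=> z; rewrite /cdisk /=; lra.
have h0 : 0 < 1 / 2 :> R by rewrite divr_gt0.
have c0 := cdisk_center 0 h0.
pose K : set R[i] := [set z | normc (z - 0) <= 1 / 2].
have cK : compact K by exact: closed_cdisk_compact.
have KD : K `<=` cdisk 0 1.
  by move=> z; rewrite /K /cdisk /=; lra.
have sub z : cdisk 0 (1 / 2) z -> K z by rewrite /cdisk /K /= => /ltW.
(* The spherical derivative of [u (s m)] at 0 exceeds [s m + 1], and [s m >= m]. *)
have Bnd (b : R) : ~ \forall m \near \oo, normc (derive1 (u (s m)) 0) <=
    b * (1 + normc (u (s m) 0) ^+ 2).
  move=> Hb.
  have [m [mb m1]] := filter_ex (filterI Hb (nbhs_infty_ger b)).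
  have [_] := uP (s m); rewrite ltNge => /negP; apply; apply: le_trans mb _.
  rewrite ler_wpM2r ?addr_ge0 ?exprn_ge0 ?normc_ge0//.
  by apply: le_trans m1 _; rewrite ler_nat ltnW// ltnS.
case: sP => [[g gP]|iP].
  have K0 : K !=set0 by exists 0; exact: sub.
  have /uniform_normcP/(_ 1 ltr01)[N _ NP] : {uniform K, (fun m => u (s m)) @ \oo --> g}.
    by apply: gP => //; rewrite unit_diskE.
  have [c _ cmax] : exists2 c, c \in K & forall t, t \in K ->
      normc (u (s N) t) <= normc (u (s N) c).
    apply: compact_EVT_max => //; apply: continuous_in_subspaceT => z; rewrite inE.
    move=> /KD zD; have uc := differentiable_continuous (uh (s N) z zD).
    exact: (normc_comp_continuous uc).
  (* All later functions are within 2 of [u (s N)] on [K], being each within 1 of [g]; the maximum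
     is taken for [u (s N)], which is known to be continuous. *)
  pose M := normc (u (s N) c) + 2.
  have M0 : 0 <= M by rewrite addr_ge0// normc_ge0.
  apply: (Bnd (4 * M / (1 / 2))); exists N => // m /= Nm.
  apply: (@le_trans _ _ (4 * M / (1 / 2))).
    apply: (cauchy_estimate h0); first by move=> z /subD; exact: uh.
    move=> z /sub zK; have := NP m Nm z zK; have := NP N (leqnn N) z zK.
    have := cmax z (mem_set zK) => h1 h2 h3.
    rewrite (_ : u (s m) z = (u (s m) z - g z) - (u (s N) z - g z) + u (s N) z);
      last by ring.
    apply: le_trans (le_normcD _ _) _.
    have := le_normcD (u (s m) z - g z) (- (u (s N) z - g z)).
    by rewrite normcN /M; lra.
  by rewrite ler_peMr ?divr_ge0 ?mulr_ge0// lerDl exprn_ge0// normc_ge0.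
have [N _ NP] : \forall m \near \oo, forall z, K z -> 1 < normc (u (s m) z).
  have := iP K cK; rewrite unit_diskE => /(_ KD 1) [N _ NP].
  exists N => // m /NP mP z zK.
  by rewrite -ltcR -normr_normc; exact: mP.
apply: (Bnd (4 * 1 / (1 / 2))); exists N => // m /= Nm.
have u1 z : cdisk 0 (1 / 2) z -> u (s m) z != 0.
  by move=> /sub zK; rewrite -normc_gt0 (lt_trans _ (NP m Nm z zK)).
(* The derivative of the inverse has modulus [|u'| / |u|^2], so its Cauchy bound also bounds the
   spherical derivative. *)
have hd : normc (derive1 (fun z => (u (s m) z)^-1) 0) <= 4 * 1 / (1 / 2).
  apply: (cauchy_estimate h0).
    by move=> z zD; apply: differentiableV; [exact/uh/subD | exact: u1].
  move=> z zD; have z1 := NP m Nm z (sub z zD).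
  by rewrite normcV invf_le1 ?(ltW z1)// (lt_trans ltr01).
have u0 := u1 0 c0; have ud := uh (s m) 0 (subD 0 c0).
have E : derive1 (fun z => (u (s m) z)^-1) 0 =
    - (u (s m) 0) ^- 2 * derive1 (u (s m)) 0.
  rewrite !derive1E deriveV//; exact/derivable1_diffP.
move: hd; rewrite E normcM normcN normcV normcX.
rewrite mulrC ler_pdivrMr ?exprn_gt0 ?normc_gt0//; move/le_trans; apply.
by rewrite ler_wpM2l ?divr_ge0// lerDr.
Qed.

End Directions.

Theorem theorem4p3 (R : realType) (n : nat) (Omega : set 'rV[R[i]]_n)
    (f : 'rV[R[i]]_n -> R[i]) :
  domain Omega ->
  kobayashi_nondegenerate Omega ->
  holomorphic_on Omega f ->
  normal_function Omega f <->
  normal_family_on_disk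
    [set g : R[i] -> R[i] | exists phi : R[i] -> 'rV[R[i]]_n,
       holomorphic_disk Omega phi /\ g = f \o phi].
Proof.
move=> [oO _] _ fh; split.
  exact: normal_function_normal_family.
exact: normal_family_normal_function.
Qed.
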